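(* Let $G$ be a finitely generated group. The holonomy Lie algebras of the derived quotients of $G$ are given, up to isomorphism of graded Lie algebras, by \[ \mathfrak{h}(G/G^{(i)})\cong\begin{cases}\mathfrak{h}(G)/\mathfrak{h}(G)'&\text{for }i=1,\\ \mathfrak{h}(G)&\text{for }i\ge 2.\end{cases} \]
   Context: $G^{(0)}=G$, $G^{(i)}=[G^{(i-1)},G^{(i-1)}]$ is the derived series of the group $G$. For a finitely generated group $G$, the holonomy Lie algebra is $\mathfrak{h}(G)=\mathfrak{lie}(H_1(G;\mathbb{Q}))/\langle\operatorname{im}\mu_G^\vee\rangle$, where $\mathfrak{lie}(V)$ is the free $\mathbb{Q}$-Lie algebra on $V$ (in degree $1$) and $\mu_G^\vee\colon H_2(G;\mathbb{Q})\to\bigwedge^2H_1(G;\mathbb{Q})\cong\mathfrak{lie}_2(H_1(G;\mathbb{Q}))$ (with $v\wedge w\leftrightarrow[v,w]$) is the dual of the cup-product map $\mu_G\colon H^1(G;\mathbb{Q})\wedge H^1(G;\mathbb{Q})\to H^2(G;\mathbb{Q})$. For a Lie algebra $\mathfrak{h}$, $\mathfrak{h}'=[\mathfrak{h},\mathfrak{h}]$. *)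

(* Defs.v *)
From HB Require Import structures.
From mathcomp Require Import all_boot all_order all_algebra.
From mathcomp Require Import generic_quotient freeg.
From mathcomp Require Import ring.
From mathcomp Require Import boolp classical_sets functions.

Set Implicit Arguments.
Unset Strict Implicit.
Unset Printing Implicit Defensive.

Import GRing.Theory.
Local Open Scope classical_set_scope.
Local Open Scope quotient_scope.
Local Open Scope ring_scope.

Record submodule (K : nzRingType) (V : lmodType K) := Submodule {
  submodule_set :> V -> Prop;
  submodule0 : submodule_set 0;
  submoduleP : forall a u v,
    submodule_set u -> submodule_set v -> submodule_set (a *: u + v) }.

Section Submodule.
Variables (K : nzRingType) (V : lmodType K).
Implicit Types (W : submodule V) (S : set V).

Lemma submoduleD W u v : W u -> W v -> W (u + v).
Proof. by move=> Wu Wv; rewrite -[u]scale1r; apply: submoduleP. Qed.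

Lemma submoduleZ W a u : W u -> W (a *: u).
Proof. by move=> Wu; rewrite -[a *: u]addr0; apply/submoduleP/submodule0. Qed.

Lemma submoduleN W u : W u -> W (- u).
Proof. by rewrite -scaleN1r; apply: submoduleZ. Qed.

Lemma submoduleB W u v : W u -> W v -> W (u - v).
Proof. by move=> Wu Wv; apply/submoduleD/submoduleN. Qed.

Lemma submodule_sum W (I : Type) (r : seq I) (P : pred I) (F : I -> V) :
  (forall i, P i -> W (F i)) -> W (\sum_(i <- r | P i) F i).
Proof.
by move=> WF; apply: big_ind => //; [apply: submodule0|apply: submoduleD].
Qed.

Definition span_set S : set V :=
  [set v | forall W : submodule V, S `<=` W -> W v].

Lemma span_set0 S : span_set S 0.
Proof. by move=> W _; apply: submodule0. Qed.

Lemma span_setP S a u v :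
  span_set S u -> span_set S v -> span_set S (a *: u + v).
Proof. by move=> Su Sv W SW; apply: submoduleP; [apply: Su|apply: Sv]. Qed.

Definition span S : submodule V := Submodule (@span_set0 S) (@span_setP S).

Lemma sub_span S : S `<=` span S.
Proof. by move=> v Sv W; apply. Qed.

Lemma span_min S W : S `<=` W -> span S `<=` W.
Proof. by move=> SW v; apply. Qed.

End Submodule.

Section QuotientModule.
Variables (K : nzRingType) (V : lmodType K) (W : submodule V).

Definition quotmod_rel (x y : V) : bool := `[< W (x - y) >].

Lemma quotmod_rel_equiv : equiv_class_of quotmod_rel.
Proof.
split=> [x|x y|y x z].
- by apply/asboolP; rewrite subrr; apply: submodule0.
- by apply/asboolP/asboolP => /submoduleN; rewrite opprB.
- move=> /asboolP xy /asboolP yz; apply/asboolP.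
  by rewrite -[x](subrK y) -addrA; apply: submoduleD.
Qed.

Canonical quotmod_equiv := EquivRelPack quotmod_rel_equiv.
Canonical quotmod_enc := defaultEncModRel quotmod_rel.

Definition quotmod := {eq_quot quotmod_rel}.
HB.instance Definition _ := EqQuotient.on quotmod.
HB.instance Definition _ := Choice.on quotmod.

Lemma quotmodP (x y : V) : \pi_quotmod x = \pi_quotmod y <-> W (x - y).
Proof.
by split=> [/eqmodP/asboolP|Wxy] //; apply/eqmodP/asboolP.
Qed.

Lemma quotmod_repr (x : V) : W (x - repr (\pi_quotmod x)).
Proof. by apply/quotmodP; rewrite reprK. Qed.

Lemma quotmod_surj (x : quotmod) : exists y, x = \pi_quotmod y.
Proof. by exists (repr x); rewrite reprK. Qed.

Definition quotmod_zero : quotmod := \pi_quotmod 0.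
Definition quotmod_opp (x : quotmod) : quotmod := \pi_quotmod (- repr x).
Definition quotmod_add (x y : quotmod) : quotmod := \pi_quotmod (repr x + repr y).
Definition quotmod_scale (a : K) (x : quotmod) : quotmod := \pi_quotmod (a *: repr x).

Lemma pi_opp x : \pi_quotmod (- x) = quotmod_opp (\pi x).
Proof.
by apply/quotmodP; rewrite opprK addrC -opprB; apply/submoduleN/quotmod_repr.
Qed.

Lemma pi_add x y : \pi_quotmod (x + y) = quotmod_add (\pi x) (\pi y).
Proof.
apply/quotmodP; rewrite opprD addrACA.
by apply: submoduleD; apply: quotmod_repr.
Qed.

Lemma pi_scale a x : \pi_quotmod (a *: x) = quotmod_scale a (\pi x).
Proof.
by apply/quotmodP; rewrite -scalerBr; apply/submoduleZ/quotmod_repr.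
Qed.

Fact quotmod_addA : associative quotmod_add.
Proof.
move=> x y z; have [{}x ->] := quotmod_surj x; have [{}y ->] := quotmod_surj y.
have [{}z ->] := quotmod_surj z.
by rewrite -(pi_add x y) -(pi_add y z) -!pi_add addrA.
Qed.

Fact quotmod_addC : commutative quotmod_add.
Proof. by move=> x y; rewrite /quotmod_add addrC. Qed.

Fact quotmod_add0 : left_id quotmod_zero quotmod_add.
Proof. by move=> x; have [{}x ->] := quotmod_surj x; rewrite -pi_add add0r. Qed.

Fact quotmod_addN : left_inverse quotmod_zero quotmod_opp quotmod_add.
Proof.
by move=> x; have [{}x ->] := quotmod_surj x; rewrite -pi_opp -pi_add addNr.
Qed.

HB.instance Definition _ := GRing.isZmodule.Build quotmod
  quotmod_addA quotmod_addC quotmod_add0 quotmod_addN.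

Fact quotmod_scaleA a b x :
  quotmod_scale a (quotmod_scale b x) = quotmod_scale (a * b) x.
Proof.
by have [{}x ->] := quotmod_surj x; rewrite -(pi_scale b x) -!pi_scale scalerA.
Qed.

Fact quotmod_scale1 : left_id 1 quotmod_scale.
Proof.
by move=> x; have [{}x ->] := quotmod_surj x; rewrite -pi_scale scale1r.
Qed.

Fact quotmod_scaleDr : right_distributive quotmod_scale +%R.
Proof.
move=> a x y; have [{}x ->] := quotmod_surj x; have [{}y ->] := quotmod_surj y.
rewrite -(pi_add x y : \pi_quotmod (x + y) = _ + _) -!pi_scale scalerDr.
exact: pi_add.
Qed.

Fact quotmod_scaleDl x : {morph quotmod_scale^~ x : a b / a + b}.
Proof.
have [{}x ->] := quotmod_surj x => a b; rewrite -!pi_scale scalerDl.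
exact: pi_add.
Qed.

HB.instance Definition _ := GRing.Zmodule_isLmodule.Build K quotmod
  quotmod_scaleA quotmod_scale1 quotmod_scaleDr quotmod_scaleDl.

Definition quotmod_pi (x : V) : quotmod := \pi_quotmod x.

Fact quotmod_pi_linear : linear quotmod_pi.
Proof. by move=> a x y; rewrite /quotmod_pi pi_add pi_scale. Qed.

HB.instance Definition _ := GRing.isLinear.Build K V quotmod _ quotmod_pi
  quotmod_pi_linear.

Lemma quotmod_piP (x y : V) : quotmod_pi x = quotmod_pi y <-> W (x - y).
Proof. exact: quotmodP. Qed.

Lemma quotmod_pi_eq0 (x : V) : quotmod_pi x = 0 <-> W x.
Proof. by rewrite -[0](linear0 quotmod_pi) quotmod_piP subr0. Qed.

Lemma quotmod_piK (x : quotmod) : quotmod_pi (repr x) = x.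
Proof. exact: reprK. Qed.

End QuotientModule.

Arguments quotmod_pi {K V} W x.

Section Homology.
Variables (K : nzRingType) (A B C : lmodType K).
Variables (f : {linear A -> B}) (g : {linear B -> C}).

Definition in_ker : pred B := fun x => g x == 0.

Fact in_ker_submod : submod_closed in_ker.
Proof.
split=> [|a u v]; rewrite unfold_in /in_ker ?linear0 // => /eqP gu /eqP gv.
by rewrite unfold_in linearP gu gv scaler0 addr0.
Qed.

HB.instance Definition _ := GRing.isSubmodClosed.Build K B in_ker in_ker_submod.

Record kermod := Kermod { kermod_val :> B; kermod_prop : in_ker kermod_val }.
HB.instance Definition _ := [isSub for kermod_val].
HB.instance Definition _ := [Choice of kermod by <:].
HB.instance Definition _ := [SubChoice_isSubLmodule of kermod by <:].

Definition boundary_set : set kermod := [set z | exists x, val z = f x].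

Fact boundary_set0 : boundary_set 0.
Proof. by exists 0; rewrite linear0. Qed.

Fact boundary_setP a u v :
  boundary_set u -> boundary_set v -> boundary_set (a *: u + v).
Proof.
by move=> [x ux] [y vy]; exists (a *: x + y); rewrite linearP -ux -vy.
Qed.

Definition boundaries : submodule kermod :=
  Submodule boundary_set0 boundary_setP.

Definition homology := quotmod boundaries.
HB.instance Definition _ := GRing.Lmodule.on homology.

End Homology.

Section FreegLift.
Variables (K : nzRingType) (X : choiceType) (M : lmodType K) (f : X -> M).

Fact fglift_zmod_morphism : zmod_morphism (fglift f).
Proof. exact: lift_is_additive. Qed.
HB.instance Definition _ := GRing.isZmodMorphism.Build {freeg X / K} M
  (fglift f) fglift_zmod_morphism.

Fact fglift_scalable : scalable (fglift f).
Proof.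
move=> a D; rewrite -[in RHS](freeg_sumE D).
have -> : a *: D = \sum_(x <- dom D) << a * coeff x D *g x >> by [].
rewrite (raddf_sum (fglift f)) (raddf_sum (fglift f)) scaler_sumr.
apply: eq_bigr => x _.
by rewrite /= !liftU scalerA.
Qed.
HB.instance Definition _ := GRing.isScalable.Build K {freeg X / K} M
  _ (fglift f) fglift_scalable.

Lemma fgliftU x : fglift f << x >> = f x.
Proof. by rewrite liftU scale1r. Qed.

Lemma fglift_sum D : fglift f D = \sum_(x <- dom D) coeff x D *: f x.
Proof.
rewrite -[in LHS](freeg_sumE D) raddf_sum; apply: eq_bigr => x _.
exact: liftU.
Qed.

End FreegLift.

Section ExteriorSquare.
Variables (K : nzRingType) (V : lmodType K).
Implicit Types (a : K) (u v w : V).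

Variant ext2_relator : set {freeg (V * V) / K} :=
| Ext2LinearL a u v w :
    ext2_relator (<< (a *: u + v, w) >> - (a *: << (u, w) >> + << (v, w) >>))
| Ext2LinearR a u v w :
    ext2_relator (<< (w, a *: u + v) >> - (a *: << (w, u) >> + << (w, v) >>))
| Ext2Alternating u : ext2_relator << (u, u) >>.

Definition ext2 := quotmod (span ext2_relator).
HB.instance Definition _ := GRing.Lmodule.on ext2.

Definition wedge u v : ext2 := quotmod_pi _ << (u, v) >>.

(* The linear map induced by a bilinear alternating f; it is independent of the
   chosen representative by ext2_lift_pi below. *)
Definition ext2_lift (M : lmodType K) (f : V -> V -> M) (x : ext2) : M :=
  fglift (fun p => f p.1 p.2) (repr x).

Section Lift.
Variables (M : lmodType K) (f : V -> V -> M).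
Hypothesis flinl : forall w, linear (f^~ w).
Hypothesis flinr : forall w, linear (f w).
Hypothesis falt : forall w, f w w = 0.

Lemma ext2_lift_pi D :
  ext2_lift f (quotmod_pi _ D) = fglift (fun p => f p.1 p.2) D.
Proof.
pose F := fglift (fun p : V * V => f p.1 p.2).
have F0 : F 0 = 0 by exact: linear0.
have FP a D1 D2 : F D1 = 0 -> F D2 = 0 -> F (a *: D1 + D2) = 0.
  by move=> F1 F2; rewrite /F linearP [X in _ *: X]F1 [X in _ + X]F2 scaler0 addr0.
have : span ext2_relator (D - repr (quotmod_pi (span ext2_relator) D)).
  exact: quotmod_repr.
move=> /(_ (Submodule F0 FP)) /= FD; apply/esym/eqP; rewrite -subr_eq0.
rewrite -raddfB; apply/eqP/FD => x [a u v w|a u v w|u] /=; rewrite /F.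
- by rewrite linearB linearP /= !fgliftU /= flinl subrr.
- by rewrite linearB linearP /= !fgliftU /= flinr subrr.
- by rewrite fgliftU /= falt.
Qed.

Lemma ext2_lift_linear : linear (ext2_lift f).
Proof.
move=> a x y; have [{}x ->] := quotmod_surj x.
have [{}y ->] := quotmod_surj y.
rewrite -!/(quotmod_pi _ _) -linearP !ext2_lift_pi; exact: linearP.
Qed.

Lemma ext2_lift_wedge u v : ext2_lift f (wedge u v) = f u v.
Proof. by rewrite ext2_lift_pi fgliftU. Qed.

End Lift.

Lemma wedge_linearl w : linear (wedge^~ w).
Proof.
move=> a u v; rewrite /wedge -linearP; apply/quotmod_piP/sub_span.
exact: Ext2LinearL.
Qed.

Lemma wedge_linearr w : linear (wedge w).
Proof.
move=> a u v; rewrite /wedge -linearP; apply/quotmod_piP/sub_span.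
exact: Ext2LinearR.
Qed.

Lemma wedge_alt w : wedge w w = 0.
Proof. by apply/quotmod_pi_eq0/sub_span/Ext2Alternating. Qed.

End ExteriorSquare.

HB.mixin Record Lmodule_isLie (K : comNzRingType) L of GRing.Lmodule K L := {
  lie : L -> L -> L;
  lie_linearl : forall z, linear (lie^~ z);
  lie_linearr : forall z, linear (lie z);
  liexx : forall x, lie x x = 0;
  lie_jacobi : forall x y z,
    lie x (lie y z) + lie y (lie z x) + lie z (lie x y) = 0 }.

#[short(type="lieAlgType")]
HB.structure Definition LieAlgebra (K : comNzRingType) :=
  {L of Lmodule_isLie K L & GRing.Lmodule K L}.

(* A grading L = (+)_n L_n is given by its projections: homog n x is the
   component of x in L_n, so that L_n is the set of fixed points of homog n. *)
HB.mixin Record Lie_isGraded (K : comNzRingType) L of LieAlgebra K L := {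
  homog : nat -> L -> L;
  homog_linear : forall n, linear (homog n);
  homog_homog : forall m n x, homog m (homog n x) = if m == n then homog n x else 0;
  homog_sum : forall x, exists N, x = \sum_(n < N) homog n x;
  homog_lie : forall m n x y,
    homog m x = x -> homog n y = y -> homog (m + n)%N (lie x y) = lie x y }.

#[short(type="gradedLieType")]
HB.structure Definition GradedLie (K : comNzRingType) :=
  {L of Lie_isGraded K L & LieAlgebra K L}.

HB.instance Definition _ (K : comNzRingType) (L : lieAlgType K) (z : L) :=
  GRing.isLinear.Build K L L _ (lie z) (@lie_linearr K L z).
HB.instance Definition _ (K : comNzRingType) (L : gradedLieType K) n :=
  GRing.isLinear.Build K L L _ (homog n) (@homog_linear K L n).

Section LieTheory.
Variables (K : comNzRingType).
Implicit Types (L : lieAlgType K).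

Lemma lieDl L (x y z : L) : (lie (x + y) z) = lie x z + lie y z.
Proof. by rewrite -[x]scale1r lie_linearl !scale1r. Qed.

Lemma lie0l L (z : L) : (lie 0 z) = 0.
Proof. by apply: (addrI (lie 0 z)); rewrite -lieDl !addr0. Qed.

Lemma lie0r L (z : L) : (lie z 0) = 0.
Proof. exact: linear0. Qed.

Lemma lieZl L a (x z : L) : (lie (a *: x) z) = a *: (lie x z).
Proof. by rewrite -[a *: x]addr0 lie_linearl lie0l addr0. Qed.

Lemma lieNl L (x z : L) : (lie (- x) z) = - lie x z.
Proof. by rewrite -scaleN1r lieZl scaleN1r. Qed.

Lemma lieBl L (x y z : L) : (lie (x - y) z) = lie x z - lie y z.
Proof. by rewrite lieDl lieNl. Qed.

Lemma lieDr L (x y z : L) : (lie z (x + y)) = lie z x + lie z y.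
Proof. exact: linearD. Qed.

Lemma lieBr L (x y z : L) : (lie z (x - y)) = lie z x - lie z y.
Proof. exact: linearB. Qed.

Lemma lieC L (x y : L) : (lie x y) = - lie y x.
Proof.
apply/eqP; rewrite -addr_eq0; apply/eqP.
by have := liexx (x + y); rewrite lieDl !lieDr !liexx add0r addr0.
Qed.

Lemma lie_suml L (I : Type) (r : seq I) (P : pred I) (F : I -> L) z :
  (lie (\sum_(i <- r | P i) F i) z) = \sum_(i <- r | P i) (lie (F i) z).
Proof. by elim/big_rec2: _ => [|i x y _ <-]; rewrite ?lie0l ?lieDl. Qed.

Lemma lie_sumr L (I : Type) (r : seq I) (P : pred I) (F : I -> L) z :
  (lie z (\sum_(i <- r | P i) F i)) = \sum_(i <- r | P i) (lie z (F i)).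
Proof. exact: linear_sum. Qed.

Definition graded_piece (L : gradedLieType K) (n : nat) : set L :=
  [set x | homog n x = x].

Lemma homog_piece (L : gradedLieType K) n (x : L) : graded_piece n (homog n x).
Proof. by rewrite /graded_piece /= homog_homog eqxx. Qed.

Lemma homog_piece_neq (L : gradedLieType K) m n (x : L) :
  graded_piece n x -> m != n -> homog m x = 0.
Proof. by move=> <- /negPf mn; rewrite homog_homog mn. Qed.

End LieTheory.

Definition graded_lie_isomorphic (K : comNzRingType) (L M : gradedLieType K) :
    Prop :=
  exists phi : {linear L -> M},
    [/\ bijective phi, {morph phi : x y / lie x y >-> lie x y}
      & forall n, phi @` graded_piece n = graded_piece n].

Section Ideals.
Variables (K : comNzRingType) (L : gradedLieType K).

Lemma submodule_homog_lie (W : submodule L) n (x y : L) :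
  (forall i j, (i + j)%N = n -> W (lie (homog i x) (homog j y))) ->
  W (homog n (lie x y)).
Proof.
move=> Wxy; have [M ->] := homog_sum x; have [N ->] := homog_sum y.
rewrite lie_suml linear_sum; apply: submodule_sum => i _.
rewrite lie_sumr linear_sum; apply: submodule_sum => j _.
have ij : homog (i + j)%N (lie (homog i x) (homog j y))
    = lie (homog i x) (homog j y).
  by apply: homog_lie; apply: homog_piece.
change (W (homog n (lie (homog i x) (homog j y)))).
have [nij|nij] := eqVneq n (i + j)%N.
  by rewrite nij ij; apply: Wxy.
by rewrite (homog_piece_neq ij nij); apply: submodule0.
Qed.

Record lie_ideal := LieIdeal {
  lie_ideal_submodule :> submodule L;
  lie_idealP : forall x y,
    lie_ideal_submodule y -> lie_ideal_submodule (lie x y) }.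

Record graded_ideal := GradedIdeal {
  graded_ideal_ideal :> lie_ideal;
  graded_idealP : forall n x,
    graded_ideal_ideal x -> graded_ideal_ideal (homog n x) }.

Section Generated.
Variable S : set L.

Definition ideal_gen_set : set L :=
  [set x | forall I : lie_ideal, S `<=` I -> I x].

Fact ideal_gen_set0 : ideal_gen_set 0.
Proof. by move=> I _; apply: submodule0. Qed.

Fact ideal_gen_setP a u v :
  ideal_gen_set u -> ideal_gen_set v -> ideal_gen_set (a *: u + v).
Proof. by move=> Su Sv I SI; apply: submoduleP; [apply: Su|apply: Sv]. Qed.

Fact ideal_gen_set_lie x y : ideal_gen_set y -> ideal_gen_set (lie x y).
Proof. by move=> Sy I SI; apply/lie_idealP/Sy. Qed.

Definition ideal_gen : lie_ideal :=
  @LieIdeal (Submodule ideal_gen_set0 ideal_gen_setP) ideal_gen_set_lie.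

Lemma sub_ideal_gen : S `<=` ideal_gen.
Proof. by move=> x Sx I; apply. Qed.

Hypothesis S_homog : forall x, S x -> exists n, graded_piece n x.

(* The elements all of whose components are in ideal_gen form an ideal. *)
Fact ideal_gen_graded n x : ideal_gen x -> ideal_gen (homog n x).
Proof.
pose T : set L := [set x | forall n, ideal_gen (homog n x)].
have T0 : T 0 by move=> m; rewrite linear0; apply: submodule0.
have TP a u v : T u -> T v -> T (a *: u + v).
  move=> Tu Tv m; rewrite linearP.
  by apply: submoduleP; [apply: Tu|apply: Tv].
have Tlie u v : T v -> T (lie u v).
  move=> Tv m; apply: submodule_homog_lie => i j _.
  by apply: lie_idealP; apply: Tv.
move=> Ix; apply: (Ix (@LieIdeal (Submodule T0 TP) Tlie)) => {x Ix} x Sx m.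
have [k xk] := S_homog Sx; have [->|mk] := eqVneq m k.
  by rewrite xk; apply: sub_ideal_gen.
by rewrite (homog_piece_neq xk mk); apply: submodule0.
Qed.

Definition graded_ideal_gen : graded_ideal := GradedIdeal ideal_gen_graded.

End Generated.

Definition derived_submodule : submodule L :=
  span [set z | exists x y : L, z = lie x y].

Fact derived_submodule_lie x y :
  derived_submodule y -> derived_submodule (lie x y).
Proof. by move=> _; apply: sub_span; exists x, y. Qed.

Definition derived_lie_ideal : lie_ideal := LieIdeal derived_submodule_lie.

Fact derived_lie_ideal_graded n x :
  derived_lie_ideal x -> derived_lie_ideal (homog n x).
Proof.
pose T : set L := [set x | derived_submodule (homog n x)].
have T0 : T 0 by rewrite /T /= linear0; exact: (submodule0 derived_submodule).
have TP a u v : T u -> T v -> T (a *: u + v).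
  by move=> Tu Tv; rewrite /T /= linearP; apply: (submoduleP (s := derived_submodule)).
apply: (@span_min K L _ (Submodule T0 TP)) => _ [u [v ->]].
apply: submodule_homog_lie => i j _.
by apply: sub_span; exists (homog i u), (homog j v).
Qed.

Definition derived_ideal : graded_ideal := GradedIdeal derived_lie_ideal_graded.

End Ideals.

Section LieQuotient.
Variables (K : comNzRingType) (L : gradedLieType K) (I : graded_ideal L).

Definition lie_quot := quotmod I.
HB.instance Definition _ := GRing.Lmodule.on lie_quot.

Local Notation pi := (quotmod_pi I : L -> lie_quot).

Definition lie_quot_lie (x y : lie_quot) : lie_quot := pi (lie (repr x) (repr y)).
Definition lie_quot_homog (n : nat) (x : lie_quot) : lie_quot :=
  pi (homog n (repr x)).

Lemma lie_quot_lieE x y : lie_quot_lie (pi x) (pi y) = pi (lie x y).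
Proof.
apply/esym/quotmod_piP; set x' := repr _; set y' := repr _.
have -> : lie x y - lie x' y' = lie x (y - y') - lie y' (x - x').
  by rewrite [lie y' _]lieC opprK lieBr lieBl addrA subrK.
apply: submoduleB; apply: lie_idealP; exact: quotmod_repr.
Qed.

Lemma lie_quot_homogE n x : lie_quot_homog n (pi x) = pi (homog n x).
Proof.
apply/esym/quotmod_piP; rewrite -linearB; apply: graded_idealP.
exact: quotmod_repr.
Qed.

Lemma lie_quot_surj (x : lie_quot) : exists y, x = pi y.
Proof. exact: quotmod_surj. Qed.

Lemma lie_quot_piP a x y : pi (a *: x + y) = a *: pi x + pi y.
Proof. exact: linearP. Qed.

Fact lie_quot_linearl z : linear (lie_quot_lie^~ z).
Proof.
move=> a x y; have [{}x ->] := lie_quot_surj x.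
have [{}y ->] := lie_quot_surj y; have [{}z ->] := lie_quot_surj z.
by rewrite -(lie_quot_piP a x y) !lie_quot_lieE lie_linearl lie_quot_piP.
Qed.

Fact lie_quot_linearr z : linear (lie_quot_lie z).
Proof.
move=> a x y; have [{}x ->] := lie_quot_surj x.
have [{}y ->] := lie_quot_surj y; have [{}z ->] := lie_quot_surj z.
by rewrite -(lie_quot_piP a x y) !lie_quot_lieE lie_linearr lie_quot_piP.
Qed.

Fact lie_quot_liexx x : lie_quot_lie x x = 0.
Proof.
by have [{}x ->] := lie_quot_surj x; rewrite lie_quot_lieE liexx linear0.
Qed.

Fact lie_quot_jacobi x y z :
  lie_quot_lie x (lie_quot_lie y z) + lie_quot_lie y (lie_quot_lie z x)
    + lie_quot_lie z (lie_quot_lie x y) = 0.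
Proof.
have [{}x ->] := lie_quot_surj x; have [{}y ->] := lie_quot_surj y.
have [{}z ->] := lie_quot_surj z.
by rewrite !lie_quot_lieE -!linearD lie_jacobi linear0.
Qed.

HB.instance Definition _ := Lmodule_isLie.Build K lie_quot
  lie_quot_linearl lie_quot_linearr lie_quot_liexx lie_quot_jacobi.

Fact lie_quot_homog_linear n : linear (lie_quot_homog n).
Proof.
move=> a x y; have [{}x ->] := lie_quot_surj x.
have [{}y ->] := lie_quot_surj y.
by rewrite -(lie_quot_piP a x y) !lie_quot_homogE homog_linear lie_quot_piP.
Qed.

Fact lie_quot_homog_homog m n x :
  lie_quot_homog m (lie_quot_homog n x)
  = if m == n then lie_quot_homog n x else 0.
Proof.
have [{}x ->] := lie_quot_surj x; rewrite !lie_quot_homogE homog_homog.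
by case: ifP; rewrite // linear0.
Qed.

Fact lie_quot_homog_sum x : exists N, x = \sum_(n < N) lie_quot_homog n x.
Proof.
have [{}x ->] := lie_quot_surj x; have [N xN] := homog_sum x; exists N.
rewrite {1}xN linear_sum; apply: eq_bigr => n _.
by rewrite lie_quot_homogE.
Qed.

Fact lie_quot_homog_lie m n (x y : lie_quot) :
  lie_quot_homog m x = x -> lie_quot_homog n y = y ->
  lie_quot_homog (m + n)%N (lie_quot_lie x y) = lie_quot_lie x y.
Proof.
have [{}x ->] := lie_quot_surj x; have [{}y ->] := lie_quot_surj y.
rewrite (lie_quot_homogE m) (lie_quot_homogE n) => <- <-; rewrite lie_quot_lieE lie_quot_homogE.
by rewrite homog_lie //; apply: homog_piece.
Qed.

HB.instance Definition _ := Lie_isGraded.Build K lie_quot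
  lie_quot_homog_linear lie_quot_homog_homog lie_quot_homog_sum
  lie_quot_homog_lie.

End LieQuotient.

Section Convolution.
Variables (K : comNzRingType) (L : lieAlgType K).
Implicit Types (x y z : nat -> L) (n N : nat).

Definition lie_conv x y n : L :=
  \sum_(i < n.+1) \sum_(j < n.+1) if (i + j == n)%N then lie (x i) (y j) else 0.

Lemma sum_widen (F : nat -> L) m N :
  (m <= N)%N -> (forall i, (m <= i)%N -> F i = 0) ->
  \sum_(i < m) F i = \sum_(i < N) F i.
Proof.
move=> mN F0; rewrite (big_ord_widen N F mN) big_mkcond /=.
by apply: eq_bigr => i _; case: ltnP => // /F0 ->.
Qed.

Lemma lie_convE x y n N : (n < N)%N ->
  lie_conv x y n =
  \sum_(i < N) \sum_(j < N) if (i + j == n)%N then lie (x i) (y j) else 0.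
Proof.
move=> nN; rewrite /lie_conv.
rewrite (sum_widen (F := fun i => \sum_(j < n.+1)
  if (i + j == n)%N then lie (x i) (y j) else 0) nN) => [|i ni].
  apply: eq_bigr => i _.
  rewrite (sum_widen
    (F := fun j => if (i + j == n)%N then lie (x i) (y j) else 0) nN) // => j nj.
  by case: eqP => // E; move: (leq_trans nj (leq_addl i j)); rewrite E ltnn.
rewrite big1 // => j _; case: eqP => // E.
by move: (leq_trans ni (leq_addr j i)); rewrite E ltnn.
Qed.

Lemma lie_conv_linearl a x y z n :
  lie_conv (fun i => a *: x i + y i) z n = a *: lie_conv x z n + lie_conv y z n.
Proof.
rewrite /lie_conv scaler_sumr -big_split; apply: eq_bigr => i _ /=.
rewrite scaler_sumr -big_split; apply: eq_bigr => j _ /=.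
by case: ifP => _; rewrite ?lie_linearl ?scaler0 ?addr0.
Qed.

Lemma lie_conv_linearr a x y z n :
  lie_conv z (fun i => a *: x i + y i) n = a *: lie_conv z x n + lie_conv z y n.
Proof.
rewrite /lie_conv scaler_sumr -big_split; apply: eq_bigr => i _ /=.
rewrite scaler_sumr -big_split; apply: eq_bigr => j _ /=.
by case: ifP => _; rewrite ?lie_linearr ?scaler0 ?addr0.
Qed.

Lemma lie_convxx x n : lie_conv x x n = 0.
Proof.
pose F i j := if (i + j == n)%N then lie (x i) (x j) else 0.
suff SF N : \sum_(i < N) \sum_(j < N) F i j = 0 by exact: SF.
elim: N => [|N IH]; first by rewrite big_ord0.
rewrite big_ord_recr /=; under eq_bigr => i _ do rewrite big_ord_recr /=.
rewrite big_split /= IH add0r big_ord_recr /= addrA -big_split /= big1.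
  by rewrite add0r /F; case: ifP; rewrite ?liexx.
by move=> i _; rewrite /F addnC; case: ifP; rewrite ?addr0 // lieC addNr.
Qed.

Lemma lie_conv_delta x y m p n : (forall i, i != m -> x i = 0) ->
  (forall j, j != p -> y j = 0) ->
  lie_conv x y n = if n == (m + p)%N then lie (x m) (y p) else 0.
Proof.
move=> x0 y0; pose N := (n + m + p).+1.
have mN : (m < N)%N by rewrite /N ltnS -addnA addnCA leq_addr.
have pN : (p < N)%N by rewrite /N ltnS leq_addl.
rewrite (@lie_convE _ _ _ N) ?ltnS -?addnA ?leq_addr //.
rewrite (bigD1 (Ordinal mN)) //= [X in _ + X]big1 => [|i im]; last first.
  by rewrite big1 // => j _; rewrite x0 ?lie0l ?if_same.
rewrite (bigD1 (Ordinal pN)) //= [X in _ + X + _]big1 => [|j jp]; last first.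
  by rewrite y0 ?lie0r ?if_same.
by rewrite !addr0 eq_sym.
Qed.

Lemma lie_conv3E x y z n :
  lie_conv x (lie_conv y z) n =
  \sum_(i < n.+1) \sum_(j < n.+1) \sum_(k < n.+1)
    if (i + j + k == n)%N then lie (x i) (lie (y j) (z k)) else 0.
Proof.
rewrite {1}/lie_conv; apply: eq_bigr => i _.
transitivity (\sum_(m < n.+1) \sum_(j < n.+1) \sum_(k < n.+1)
    if (i + m == n)%N && (j + k == m)%N
    then lie (x i) (lie (y j) (z k)) else 0).
  apply: eq_bigr => m _; case: ifP => _ /=; last first.
    by rewrite big1 // => j _; rewrite big1.
  rewrite (lie_convE _ _ (ltn_ord m)) lie_sumr; apply: eq_bigr => j _.
  rewrite lie_sumr; apply: eq_bigr => k _.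
  by case: ifP; rewrite ?lie0r.
rewrite exchange_big; apply: eq_bigr => j _ /=.
rewrite exchange_big; apply: eq_bigr => k _ /=.
have [jk|jk] := ltnP (j + k) n.+1.
  rewrite (bigD1 (Ordinal jk)) //= eqxx andbT addnA big1 ?addr0 // => m mjk.
  case: eqP => //= _; case: eqP => // E; case/eqP: mjk.
  by apply: val_inj; rewrite /= E.
rewrite big1 => [|m _]; last first.
  case: eqP => //= _; case: eqP => // E.
  by move: jk; rewrite E ltnNge -ltnS ltn_ord.
case: eqP => // E.
by move: (leq_trans jk (leq_addl i _)); rewrite addnA E ltnn.
Qed.

Lemma lie_conv_jacobi x y z n :
  lie_conv x (lie_conv y z) n + lie_conv y (lie_conv z x) n
    + lie_conv z (lie_conv x y) n = 0.
Proof.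
rewrite !lie_conv3E [X in _ + X + _]exchange_big /=.
under [X in _ + X + _]eq_bigr => k _ do rewrite exchange_big /=.
rewrite [X in _ + X + _]exchange_big /=.
under [X in _ + X + _]eq_bigr => i _ do rewrite exchange_big /=.
rewrite [X in _ + _ + X]exchange_big /=.
under [X in _ + _ + X]eq_bigr => i _ do rewrite exchange_big /=.
rewrite -!big_split big1 // => i _; rewrite -!big_split big1 // => j _.
rewrite -!big_split big1 // => k _ /=.
have -> : (j + k + i = i + j + k)%N by rewrite addnC addnA.
have -> : (k + i + j = i + j + k)%N by rewrite -addnA addnC.
by case: ifP => _; rewrite ?lie_jacobi // !addr0.
Qed.

End Convolution.

Section FreeLie.
Variables (K : comNzRingType) (V : lmodType K).

Inductive lie_term :=
| LieGen of V
| LieZero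
| LieOpp of lie_term
| LieAdd of lie_term & lie_term
| LieScale of K & lie_term
| LieBracket of lie_term & lie_term.

HB.instance Definition _ := gen_eqMixin lie_term.
HB.instance Definition _ := gen_choiceMixin lie_term.

(* The least congruence making the terms a Lie algebra in which LieGen is
   linear. *)
Inductive lie_congr : lie_term -> lie_term -> Prop :=
| LieRefl s : lie_congr s s
| LieSym s t : lie_congr s t -> lie_congr t s
| LieTrans s t r : lie_congr s t -> lie_congr t r -> lie_congr s r
| LieOppCongr s s' : lie_congr s s' -> lie_congr (LieOpp s) (LieOpp s')
| LieAddCongr s s' t t' : lie_congr s s' -> lie_congr t t' ->
    lie_congr (LieAdd s t) (LieAdd s' t')
| LieScaleCongr a s s' : lie_congr s s' ->
    lie_congr (LieScale a s) (LieScale a s')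
| LieBracketCongr s s' t t' : lie_congr s s' -> lie_congr t t' ->
    lie_congr (LieBracket s t) (LieBracket s' t')
| LieAddA s t r :
    lie_congr (LieAdd s (LieAdd t r)) (LieAdd (LieAdd s t) r)
| LieAddC s t : lie_congr (LieAdd s t) (LieAdd t s)
| LieAdd0 s : lie_congr (LieAdd LieZero s) s
| LieAddN s : lie_congr (LieAdd (LieOpp s) s) LieZero
| LieScaleA a b s :
    lie_congr (LieScale a (LieScale b s)) (LieScale (a * b) s)
| LieScale1 s : lie_congr (LieScale 1 s) s
| LieScaleDr a s t : lie_congr (LieScale a (LieAdd s t))
    (LieAdd (LieScale a s) (LieScale a t))
| LieScaleDl a b s : lie_congr (LieScale (a + b) s)
    (LieAdd (LieScale a s) (LieScale b s))
| LieGenLinear a u v : lie_congr (LieGen (a *: u + v))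
    (LieAdd (LieScale a (LieGen u)) (LieGen v))
| LieLinearL a s t r : lie_congr (LieBracket (LieAdd (LieScale a s) t) r)
    (LieAdd (LieScale a (LieBracket s r)) (LieBracket t r))
| LieLinearR a s t r : lie_congr (LieBracket r (LieAdd (LieScale a s) t))
    (LieAdd (LieScale a (LieBracket r s)) (LieBracket r t))
| LieAlternating s : lie_congr (LieBracket s s) LieZero
| LieJacobi s t r : lie_congr
    (LieAdd (LieAdd (LieBracket s (LieBracket t r))
                    (LieBracket t (LieBracket r s)))
            (LieBracket r (LieBracket s t))) LieZero.

Definition lie_rel (s t : lie_term) : bool := `[< lie_congr s t >].

Lemma lie_rel_equiv : equiv_class_of lie_rel.
Proof.
split=> [s|s t|t s r].
- by apply/asboolP/LieRefl.
- by apply/asboolP/asboolP => /LieSym.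
- by move=> /asboolP st /asboolP tr; apply/asboolP/(LieTrans st).
Qed.

Canonical lie_rel_equivRel := EquivRelPack lie_rel_equiv.
Canonical lie_rel_encModRel := defaultEncModRel lie_rel.

Definition free_lie := {eq_quot lie_rel}.
HB.instance Definition _ := EqQuotient.on free_lie.
HB.instance Definition _ := Choice.on free_lie.

Local Notation cl := (\pi_free_lie : lie_term -> free_lie).

Lemma free_lieP s t : cl s = cl t <-> lie_congr s t.
Proof. by split=> [/eqmodP/asboolP|st] //; apply/eqmodP/asboolP. Qed.

Lemma free_lie_repr s : lie_congr s (repr (cl s)).
Proof. by apply/free_lieP; rewrite reprK. Qed.

Lemma free_lie_surj (x : free_lie) : exists s, x = cl s.
Proof. by exists (repr x); rewrite reprK. Qed.

Definition free_lie_zero : free_lie := cl LieZero.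
Definition free_lie_opp (x : free_lie) : free_lie := cl (LieOpp (repr x)).
Definition free_lie_add (x y : free_lie) : free_lie :=
  cl (LieAdd (repr x) (repr y)).
Definition free_lie_scale (a : K) (x : free_lie) : free_lie :=
  cl (LieScale a (repr x)).
Definition free_lie_lie (x y : free_lie) : free_lie :=
  cl (LieBracket (repr x) (repr y)).

Lemma free_lie_oppE s : free_lie_opp (cl s) = cl (LieOpp s).
Proof. by apply/esym/free_lieP/LieOppCongr/free_lie_repr. Qed.

Lemma free_lie_addE s t : free_lie_add (cl s) (cl t) = cl (LieAdd s t).
Proof. by apply/esym/free_lieP/LieAddCongr; apply/free_lie_repr. Qed.

Lemma free_lie_scaleE a s : free_lie_scale a (cl s) = cl (LieScale a s).
Proof. by apply/esym/free_lieP/LieScaleCongr/free_lie_repr. Qed.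

Lemma free_lie_lieE s t : free_lie_lie (cl s) (cl t) = cl (LieBracket s t).
Proof. by apply/esym/free_lieP/LieBracketCongr; apply/free_lie_repr. Qed.

Let opE := (free_lie_oppE, free_lie_addE, free_lie_scaleE, free_lie_lieE).

Ltac lift_terms := repeat match goal with
  x : _ |- _ => have [{}x ->] := free_lie_surj x end.

Fact free_lie_addA : associative free_lie_add.
Proof.
move=> x y z; lift_terms; rewrite !opE; exact/free_lieP/LieAddA.
Qed.

Fact free_lie_addC : commutative free_lie_add.
Proof. by move=> x y; lift_terms; rewrite !opE; apply/free_lieP/LieAddC. Qed.

Fact free_lie_add0 : left_id free_lie_zero free_lie_add.
Proof.
by move=> x; lift_terms; rewrite /free_lie_zero !opE; apply/free_lieP/LieAdd0.
Qed.

Fact free_lie_addN : left_inverse free_lie_zero free_lie_opp free_lie_add.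
Proof.
by move=> x; lift_terms; rewrite /free_lie_zero !opE; apply/free_lieP/LieAddN.
Qed.

HB.instance Definition _ := GRing.isZmodule.Build free_lie
  free_lie_addA free_lie_addC free_lie_add0 free_lie_addN.

Lemma free_lie_addrE s t : cl s + cl t = cl (LieAdd s t).
Proof. exact: free_lie_addE. Qed.

Fact free_lie_scaleA a b x :
  free_lie_scale a (free_lie_scale b x) = free_lie_scale (a * b) x.
Proof. by lift_terms; rewrite !opE; apply/free_lieP/LieScaleA. Qed.

Fact free_lie_scale1 : left_id 1 free_lie_scale.
Proof. by move=> x; lift_terms; rewrite !opE; apply/free_lieP/LieScale1. Qed.

Fact free_lie_scaleDr : right_distributive free_lie_scale +%R.
Proof.
move=> a x y; lift_terms; rewrite free_lie_addrE !opE free_lie_addrE.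
exact/free_lieP/LieScaleDr.
Qed.

Fact free_lie_scaleDl x : {morph free_lie_scale^~ x : a b / a + b}.
Proof.
move=> a b; lift_terms; rewrite !opE free_lie_addrE.
exact/free_lieP/LieScaleDl.
Qed.

HB.instance Definition _ := GRing.Zmodule_isLmodule.Build K free_lie
  free_lie_scaleA free_lie_scale1 free_lie_scaleDr free_lie_scaleDl.

Lemma free_lie_scalerE a s : a *: cl s = cl (LieScale a s).
Proof. exact: free_lie_scaleE. Qed.

Fact free_lie_linearl z : linear (free_lie_lie^~ z).
Proof.
move=> a x y; lift_terms.
rewrite free_lie_scalerE free_lie_addrE !opE free_lie_scalerE free_lie_addrE.
exact/free_lieP/LieLinearL.
Qed.

Fact free_lie_linearr z : linear (free_lie_lie z).
Proof.
move=> a x y; lift_terms.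
rewrite free_lie_scalerE free_lie_addrE !opE free_lie_scalerE free_lie_addrE.
exact/free_lieP/LieLinearR.
Qed.

Fact free_lie_liexx x : free_lie_lie x x = 0.
Proof. by lift_terms; rewrite !opE; apply/free_lieP/LieAlternating. Qed.

Fact free_lie_jacobi x y z :
  free_lie_lie x (free_lie_lie y z) + free_lie_lie y (free_lie_lie z x)
    + free_lie_lie z (free_lie_lie x y) = 0.
Proof.
lift_terms; rewrite !opE !free_lie_addrE; exact/free_lieP/LieJacobi.
Qed.

HB.instance Definition _ := Lmodule_isLie.Build K free_lie
  free_lie_linearl free_lie_linearr free_lie_liexx free_lie_jacobi.

Lemma free_lie_lierE s t : lie (cl s) (cl t) = cl (LieBracket s t).
Proof. exact: free_lie_lieE. Qed.

Lemma free_lie_opprE s : - cl s = cl (LieOpp s).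
Proof. exact: free_lie_oppE. Qed.

Definition free_lie_gen (v : V) : free_lie := cl (LieGen v).

Fact free_lie_gen_linear : linear free_lie_gen.
Proof.
move=> a u v; rewrite /free_lie_gen free_lie_scalerE free_lie_addrE.
exact/free_lieP/LieGenLinear.
Qed.

HB.instance Definition _ := GRing.isLinear.Build K V free_lie _ free_lie_gen
  free_lie_gen_linear.

Fixpoint lie_term_homog (t : lie_term) (n : nat) : free_lie :=
  match t with
  | LieGen v => if n == 1%N then free_lie_gen v else 0
  | LieZero => 0
  | LieOpp s => - lie_term_homog s n
  | LieAdd s t => lie_term_homog s n + lie_term_homog t n
  | LieScale a s => a *: lie_term_homog s n
  | LieBracket s t => lie_conv (lie_term_homog s) (lie_term_homog t) n
  end.

Lemma lie_term_homogP s t :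
  lie_congr s t -> lie_term_homog s =1 lie_term_homog t.
Proof.
have cvl x x' y n : x =1 x' -> lie_conv x y n = lie_conv x' y n :> free_lie.
  by move=> /funext ->.
have cvr x x' y n : x =1 x' -> lie_conv y x n = lie_conv y x' n :> free_lie.
  by move=> /funext ->.
elim=> {s t} /=.
- by [].
- by move=> s t _ IH n; rewrite IH.
- by move=> s t r _ IH1 _ IH2 n; rewrite IH1.
- by move=> s s' _ IH n; rewrite IH.
- by move=> s s' t t' _ IH1 _ IH2 n; rewrite IH1 IH2.
- by move=> a s s' _ IH n; rewrite IH.
- by move=> s s' t t' _ IH1 _ IH2 n; rewrite (cvl _ _ _ _ IH1) (cvr _ _ _ _ IH2).
- by move=> s t r n; rewrite addrA.
- by move=> s t n; rewrite addrC.
- by move=> s n; rewrite add0r.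
- by move=> s n; rewrite addNr.
- by move=> a b s n; rewrite scalerA.
- by move=> s n; rewrite scale1r.
- by move=> a s t n; rewrite scalerDr.
- by move=> a b s n; rewrite scalerDl.
- by move=> a u v n; case: ifP => _; rewrite ?linearP ?scaler0 ?addr0.
- by move=> a s t r n; exact: lie_conv_linearl.
- by move=> a s t r n; exact: lie_conv_linearr.
- by move=> s n; exact: lie_convxx.
- by move=> s t r n; exact: lie_conv_jacobi.
Qed.

Definition free_lie_homog (n : nat) (x : free_lie) : free_lie :=
  lie_term_homog (repr x) n.

Lemma free_lie_homogE n t : free_lie_homog n (cl t) = lie_term_homog t n.
Proof. by apply/lie_term_homogP/LieSym/free_lie_repr. Qed.

Fact free_lie_homog_linear n : linear (free_lie_homog n).
Proof.
move=> a x y; lift_terms.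
by rewrite free_lie_scalerE free_lie_addrE !free_lie_homogE.
Qed.

HB.instance Definition _ n := GRing.isLinear.Build K free_lie free_lie _
  (free_lie_homog n) (free_lie_homog_linear n).

Lemma free_lie_homog_conv n x y :
  free_lie_homog n (lie x y)
  = lie_conv (free_lie_homog^~ x) (free_lie_homog^~ y) n.
Proof.
lift_terms; rewrite free_lie_lierE free_lie_homogE /=.
by congr lie_conv; apply/funext => i; rewrite free_lie_homogE.
Qed.

Fact free_lie_homog_homog m n x :
  free_lie_homog m (free_lie_homog n x) = if m == n then free_lie_homog n x else 0.
Proof.
lift_terms; rewrite free_lie_homogE; elim: x m n => /=.
- move=> v m n; have [->|n1] := eqVneq n 1%N.
    by rewrite free_lie_homogE /=.
  by rewrite linear0 if_same.
- by move=> m n; rewrite linear0 if_same.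
- by move=> s IH m n; rewrite linearN /= IH; case: ifP; rewrite ?oppr0.
- by move=> s IHs t IHt m n; rewrite linearD /= IHs IHt; case: ifP; rewrite ?addr0.
- by move=> a s IH m n; rewrite linearZ /= IH; case: ifP; rewrite ?scaler0.
move=> s IHs t IHt m n; rewrite /lie_conv linear_sum /=.
have [->|mn] := eqVneq m n.
  apply: eq_bigr => i _; rewrite linear_sum; apply: eq_bigr => j _ /=.
  case: eqP => // ij; last by rewrite linear0.
  rewrite free_lie_homog_conv (@lie_conv_delta _ _ _ _ i j).
  - by rewrite IHs IHt !eqxx ij eqxx.
  - by move=> k /negPf ki; rewrite IHs ki.
  - by move=> k /negPf kj; rewrite IHt kj.
rewrite big1 // => i _; rewrite linear_sum big1 // => j _ /=.
case: eqP => // ij; last by rewrite linear0.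
rewrite free_lie_homog_conv (@lie_conv_delta _ _ _ _ i j).
- by rewrite ij (negPf mn).
- by move=> k /negPf ki; rewrite IHs ki.
- by move=> k /negPf kj; rewrite IHt kj.
Qed.

Fact free_lie_homog_lie m n x y :
  free_lie_homog m x = x -> free_lie_homog n y = y ->
  free_lie_homog (m + n)%N (lie x y) = lie x y.
Proof.
move=> xm yn; rewrite free_lie_homog_conv (@lie_conv_delta _ _ _ _ m n).
- by rewrite eqxx xm yn.
- by move=> i /negPf im; rewrite -xm free_lie_homog_homog im.
- by move=> i /negPf im; rewrite -yn free_lie_homog_homog im.
Qed.

Let bounded (x : free_lie) :=
  exists N, forall M, (N <= M)%N -> x = \sum_(n < M) free_lie_homog n x.

Let bounded_homog n x : free_lie_homog n x = x -> bounded x.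
Proof.
move=> xn; exists n.+1 => M nM; rewrite (bigD1 (Ordinal nM)) //= xn.
rewrite big1 ?addr0 // => i /eqP im; rewrite -xn free_lie_homog_homog.
by case: eqP => // E; case: im; apply: val_inj.
Qed.

Let bounded0 : bounded 0.
Proof. by apply: (@bounded_homog 0); rewrite linear0. Qed.

Let boundedP a x y : bounded x -> bounded y -> bounded (a *: x + y).
Proof.
move=> [N xN] [N' yN]; exists (maxn N N') => M; rewrite geq_max => /andP[NM NM'].
rewrite {1}(xN _ NM) {1}(yN _ NM') scaler_sumr -big_split.
by apply: eq_bigr => n _; rewrite linearP.
Qed.

Let bounded_submod : submodule free_lie := Submodule bounded0 boundedP.

Fact free_lie_homog_sum x : exists N, x = \sum_(n < N) free_lie_homog n x.
Proof.
suff [N xN] : bounded x by exists N; exact: xN.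
lift_terms; elim: x => [v||s IH|s IHs t IHt|a s IH|s IHs t IHt].
- by apply: (@bounded_homog 1); rewrite free_lie_homogE.
- exact: bounded0.
- rewrite -free_lie_opprE; exact: (@submoduleN _ _ bounded_submod).
- rewrite -free_lie_addrE; exact: (@submoduleD _ _ bounded_submod).
- rewrite -free_lie_scalerE; exact: (@submoduleZ _ _ bounded_submod).
rewrite -free_lie_lierE; have [M sM] := IHs; have [N tN] := IHt.
rewrite (sM M) // (tN N) // lie_suml.
apply: (@submodule_sum _ _ bounded_submod) => i _; rewrite lie_sumr.
apply: (@submodule_sum _ _ bounded_submod) => j _.
apply: (@bounded_homog (i + j)); apply: free_lie_homog_lie;
  by rewrite free_lie_homog_homog eqxx.
Qed.

HB.instance Definition _ := Lie_isGraded.Build K free_lie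
  free_lie_homog_linear free_lie_homog_homog free_lie_homog_sum
  free_lie_homog_lie.

Lemma free_lie_gen_piece v : graded_piece 1 (free_lie_gen v).
Proof. exact: free_lie_homogE. Qed.

Section Lift.
Variables (L : lieAlgType K) (f : {linear V -> L}).

Fixpoint lie_term_eval (t : lie_term) : L :=
  match t with
  | LieGen v => f v
  | LieZero => 0
  | LieOpp s => - lie_term_eval s
  | LieAdd s t => lie_term_eval s + lie_term_eval t
  | LieScale a s => a *: lie_term_eval s
  | LieBracket s t => lie (lie_term_eval s) (lie_term_eval t)
  end.

Lemma lie_term_evalP s t : lie_congr s t -> lie_term_eval s = lie_term_eval t.
Proof.
elim=> {s t} //=.
- by move=> s t r _ -> _ ->.
- by move=> s s' _ ->.
- by move=> s s' t t' _ -> _ ->.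
- by move=> a s s' _ ->.
- by move=> s s' t t' _ -> _ ->.
- by move=> s t r; rewrite addrA.
- by move=> s t; rewrite addrC.
- by move=> s; rewrite add0r.
- by move=> s; rewrite addNr.
- by move=> a b s; rewrite scalerA.
- by move=> s; rewrite scale1r.
- by move=> a s t; rewrite scalerDr.
- by move=> a b s; rewrite scalerDl.
- by move=> a u v; rewrite linearP.
- by move=> a s t r; rewrite lie_linearl.
- by move=> a s t r; rewrite lie_linearr.
- by move=> s; rewrite liexx.
- by move=> s t r; rewrite lie_jacobi.
Qed.

Definition free_lie_lift (x : free_lie) : L := lie_term_eval (repr x).

Lemma free_lie_liftE t : free_lie_lift (cl t) = lie_term_eval t.
Proof. by apply/lie_term_evalP/LieSym/free_lie_repr. Qed.

Fact free_lie_lift_linear : linear free_lie_lift.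
Proof.
move=> a x y; lift_terms.
by rewrite free_lie_scalerE free_lie_addrE !free_lie_liftE.
Qed.

HB.instance Definition _ := GRing.isLinear.Build K free_lie L _ free_lie_lift
  free_lie_lift_linear.

Lemma free_lie_lift_gen v : free_lie_lift (free_lie_gen v) = f v.
Proof. exact: free_lie_liftE. Qed.

Lemma free_lie_lift_lie :
  {morph free_lie_lift : x y / lie x y >-> lie x y}.
Proof.
by move=> x y; lift_terms; rewrite free_lie_lierE !free_lie_liftE.
Qed.

Lemma free_lie_lift_unique (g : {linear free_lie -> L}) :
  {morph g : x y / lie x y >-> lie x y} ->
  (forall v, g (free_lie_gen v) = f v) -> g =1 free_lie_lift.
Proof.
move=> glie ggen x; have [{}x ->] := free_lie_surj x; rewrite free_lie_liftE.
elim: x => /= [v||s <-|s <- t <-|a s <-|s <- t <-].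
- exact: ggen.
- exact: linear0.
- by rewrite -free_lie_opprE linearN.
- by rewrite -free_lie_addrE linearD.
- by rewrite -free_lie_scalerE linearZ.
- by rewrite -free_lie_lierE glie.
Qed.

End Lift.

End FreeLie.

Local Open Scope group_scope.

Record subgroup (G : groupType) := Subgroup {
  subgroup_set :> G -> Prop;
  subgroup1 : subgroup_set 1;
  subgroupM : forall x y,
    subgroup_set x -> subgroup_set y -> subgroup_set (x * y);
  subgroupV : forall x, subgroup_set x -> subgroup_set x^-1 }.

Record normal_subgroup (G : groupType) := NormalSubgroup {
  normal_subgroup_subgroup :> subgroup G;
  normal_subgroupJ : forall x y,
    normal_subgroup_subgroup x -> normal_subgroup_subgroup (x ^ y) }.

Section GeneratedSubgroup.
Variables (G : groupType) (S : set G).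

Definition subgroup_gen_set : set G :=
  [set x | forall H : subgroup G, S `<=` H -> H x].

Fact subgroup_gen_set1 : subgroup_gen_set 1.
Proof. by move=> H _; apply: subgroup1. Qed.

Fact subgroup_gen_setM x y :
  subgroup_gen_set x -> subgroup_gen_set y -> subgroup_gen_set (x * y).
Proof. by move=> Sx Sy H SH; apply: subgroupM; [apply: Sx|apply: Sy]. Qed.

Fact subgroup_gen_setV x : subgroup_gen_set x -> subgroup_gen_set x^-1.
Proof. by move=> Sx H SH; apply/subgroupV/Sx. Qed.

Definition subgroup_gen : subgroup G :=
  Subgroup subgroup_gen_set1 subgroup_gen_setM subgroup_gen_setV.

Lemma sub_subgroup_gen : S `<=` subgroup_gen.
Proof. by move=> x Sx H; apply. Qed.

Lemma subgroup_genJ : (forall x y, S x -> S (x ^ y)) ->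
  forall x y, subgroup_gen x -> subgroup_gen (x ^ y).
Proof.
move=> SJ x y; pose T : set G := [set x | subgroup_gen (x ^ y)].
have T1 : T 1 by rewrite /T /= conj1g; apply: subgroup_gen_set1.
have TM u v : T u -> T v -> T (u * v).
  by move=> Tu Tv; rewrite /T /= conjMg; apply: subgroup_gen_setM.
have TV u : T u -> T u^-1.
  by move=> Tu; rewrite /T /= conjVg; apply: subgroup_gen_setV.
move=> Sx; apply: (Sx (Subgroup T1 TM TV)) => u Su.
by apply: sub_subgroup_gen; apply: SJ.
Qed.

End GeneratedSubgroup.

Definition finitely_generated (G : groupType) : Prop :=
  exists s : seq G, forall x, subgroup_gen [set y | y \in s] x.

Section DerivedSeries.
Variable G : groupType.

Definition commutator_subgroup (A B : set G) : subgroup G :=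
  subgroup_gen [set z | exists x y, [/\ A x, B y & z = [~ x, y]]].

Fixpoint derived_set (i : nat) : set G :=
  if i is j.+1 then commutator_subgroup (derived_set j) (derived_set j)
  else [set: G].

Fact derived_set1 i : derived_set i 1.
Proof. by case: i => [|i] //=; apply: subgroup_gen_set1. Qed.

Fact derived_setM i x y :
  derived_set i x -> derived_set i y -> derived_set i (x * y).
Proof. by case: i => [|i] //=; apply: subgroup_gen_setM. Qed.

Fact derived_setV i x : derived_set i x -> derived_set i x^-1.
Proof. by case: i => [|i] //=; apply: subgroup_gen_setV. Qed.

Fact derived_setJ i x y : derived_set i x -> derived_set i (x ^ y).
Proof.
elim: i x y => [|i IH] x y //=; apply: subgroup_genJ => {x y} _ z [x [y [Dx Dy ->]]].
by exists (x ^ z), (y ^ z); rewrite conjRg; split=> //; apply: IH.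
Qed.

Definition derived_series (i : nat) : normal_subgroup G :=
  @NormalSubgroup G (Subgroup (derived_set1 i) (@derived_setM i) (@derived_setV i))
    (@derived_setJ i).

End DerivedSeries.

Section QuotientGroup.
Variables (G : groupType) (N : normal_subgroup G).

Definition quotgroup_rel (x y : G) : bool := `[< N (x^-1 * y) >].

Lemma quotgroup_rel_equiv : equiv_class_of quotgroup_rel.
Proof.
split=> [x|x y|y x z].
- by apply/asboolP; rewrite mulVg; apply: subgroup1.
- by apply/asboolP/asboolP => /subgroupV; rewrite invgM invgK.
- move=> /asboolP xy /asboolP yz; apply/asboolP.
  by rewrite -[z](mulVKg y) mulgA; apply: subgroupM.
Qed.

Canonical quotgroup_equiv := EquivRelPack quotgroup_rel_equiv.
Canonical quotgroup_enc := defaultEncModRel quotgroup_rel.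

Definition quotgroup := {eq_quot quotgroup_rel}.
HB.instance Definition _ := EqQuotient.on quotgroup.
HB.instance Definition _ := Choice.on quotgroup.

Definition quotgroup_pi (x : G) : quotgroup := \pi_quotgroup x.

Lemma quotgroup_piP x y : quotgroup_pi x = quotgroup_pi y <-> N (x^-1 * y).
Proof. by split=> [/eqmodP/asboolP|Nxy] //; apply/eqmodP/asboolP. Qed.

Lemma quotgroup_repr x : N (x^-1 * repr (quotgroup_pi x)).
Proof. by apply/quotgroup_piP; rewrite /quotgroup_pi reprK. Qed.

Lemma quotgroup_surj (x : quotgroup) : exists y, x = quotgroup_pi y.
Proof. by exists (repr x); rewrite /quotgroup_pi reprK. Qed.

Definition quotgroup_one : quotgroup := quotgroup_pi 1.
Definition quotgroup_inv (x : quotgroup) : quotgroup :=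
  quotgroup_pi (repr x)^-1.
Definition quotgroup_mul (x y : quotgroup) : quotgroup :=
  quotgroup_pi (repr x * repr y).

Lemma quotgroup_mulE x y :
  quotgroup_mul (quotgroup_pi x) (quotgroup_pi y) = quotgroup_pi (x * y).
Proof.
apply/esym/quotgroup_piP; set x' := repr _; set y' := repr _.
have -> : (x * y)^-1 * (x' * y') = (x^-1 * x') ^ y * (y^-1 * y').
  by rewrite /conjg invgM !mulgA mulgK.
by apply: subgroupM; [apply: normal_subgroupJ|]; apply: quotgroup_repr.
Qed.

Lemma quotgroup_invE x : quotgroup_inv (quotgroup_pi x) = quotgroup_pi x^-1.
Proof.
apply/esym/quotgroup_piP; set x' := repr _.
have -> : x^-1^-1 * x'^-1 = ((x^-1 * x')^-1) ^ x^-1.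
  by rewrite /conjg invgM !invgK !mulgA mulgK.
by apply/normal_subgroupJ/subgroupV/quotgroup_repr.
Qed.

Fact quotgroup_mulA : associative quotgroup_mul.
Proof.
move=> x y z; have [{}x ->] := quotgroup_surj x.
have [{}y ->] := quotgroup_surj y; have [{}z ->] := quotgroup_surj z.
by rewrite (quotgroup_mulE x y) (quotgroup_mulE y z) !quotgroup_mulE mulgA.
Qed.

Fact quotgroup_mul1 : left_id quotgroup_one quotgroup_mul.
Proof.
by move=> x; have [{}x ->] := quotgroup_surj x; rewrite quotgroup_mulE mul1g.
Qed.

Fact quotgroup_mulr1 : right_id quotgroup_one quotgroup_mul.
Proof.
by move=> x; have [{}x ->] := quotgroup_surj x; rewrite quotgroup_mulE mulg1.
Qed.

Fact quotgroup_mulV : left_inverse quotgroup_one quotgroup_inv quotgroup_mul.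
Proof.
move=> x; have [{}x ->] := quotgroup_surj x.
by rewrite quotgroup_invE quotgroup_mulE mulVg.
Qed.

Fact quotgroup_mulrV : right_inverse quotgroup_one quotgroup_inv quotgroup_mul.
Proof.
move=> x; have [{}x ->] := quotgroup_surj x.
by rewrite quotgroup_invE quotgroup_mulE mulgV.
Qed.

HB.instance Definition _ := isGroup.Build quotgroup
  quotgroup_mulA quotgroup_mul1 quotgroup_mulr1 quotgroup_mulV quotgroup_mulrV.

Lemma quotgroup_piM : {morph quotgroup_pi : x y / x * y}.
Proof. by move=> x y; rewrite -quotgroup_mulE. Qed.

End QuotientGroup.

Local Close Scope group_scope.

Section GroupHomology.
Variable G : groupType.

(* The inhomogeneous bar complex C_3 -> C_2 -> C_1 -> C_0 with trivial
   coefficients, C_n being free on G^n, and its dual cochain complex.  The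
   differential C_1 -> C_0 = Q, as well as its dual, vanishes. *)
Definition bar1 : {freeg G / rat} -> rat^o := fglift (fun=> 0).

Definition bar2 : {freeg (G * G) / rat} -> {freeg G / rat} :=
  fglift (fun p => << p.2 >> - << (p.1 * p.2)%g >> + << p.1 >>).

Definition bar3 : {freeg (G * G * G) / rat} -> {freeg (G * G) / rat} :=
  fglift (fun t => let: (g, h, k) := t in
    << (h, k) >> - << ((g * h)%g, k) >> + << (g, (h * k)%g) >> - << (g, h) >>).

HB.instance Definition _ := GRing.Linear.on bar1.
HB.instance Definition _ := GRing.Linear.on bar2.
HB.instance Definition _ := GRing.Linear.on bar3.

Definition cobar0 (c : rat^o) : G -> rat^o := fun=> 0.

Definition cobar1 (c : G -> rat^o) : G * G -> rat^o :=
  fun p => c p.2 - c (p.1 * p.2)%g + c p.1.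

Definition cobar2 (c : G * G -> rat^o) : G * G * G -> rat^o :=
  fun t => let: (g, h, k) := t in
    c (h, k) - c ((g * h)%g, k) + c (g, (h * k)%g) - c (g, h).

Fact cobar0_linear : linear cobar0.
Proof. by move=> a c d; apply/funext => g; rewrite /= scaler0 addr0. Qed.

Fact cobar1_linear : linear cobar1.
Proof.
move=> a c d; apply/funext => p; rewrite /cobar1 !fctE /=.
have E (x y z x' y' z' : rat) : (a * x + x') - (a * y + y') + (a * z + z')
  = a * (x - y + z) + (x' - y' + z') by ring.
exact: E.
Qed.

Fact cobar2_linear : linear cobar2.
Proof.
move=> a c d; apply/funext => -[[g h] k]; rewrite /cobar2 !fctE /=.
have E (x y z t x' y' z' t' : rat) :
    (a * x + x') - (a * y + y') + (a * z + z') - (a * t + t')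
  = a * (x - y + z - t) + (x' - y' + z' - t') by ring.
exact: E.
Qed.

HB.instance Definition _ := GRing.isLinear.Build rat rat^o (G -> rat^o) _
  cobar0 cobar0_linear.
HB.instance Definition _ := GRing.isLinear.Build rat (G -> rat^o)
  (G * G -> rat^o) _ cobar1 cobar1_linear.
HB.instance Definition _ := GRing.isLinear.Build rat (G * G -> rat^o)
  (G * G * G -> rat^o) _ cobar2 cobar2_linear.

Definition homology1 := homology bar2 bar1.
Definition homology2 := homology bar3 bar2.
Definition cohomology1 := homology cobar0 cobar1.
Definition cohomology2 := homology cobar1 cobar2.
HB.instance Definition _ := GRing.Lmodule.on homology1.
HB.instance Definition _ := GRing.Lmodule.on homology2.
HB.instance Definition _ := GRing.Lmodule.on cohomology1.
HB.instance Definition _ := GRing.Lmodule.on cohomology2.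

(* The Kronecker pairings, evaluating cocycles on cycles; they do not depend on
   the representatives by kronecker1E and kronecker2E. *)
Definition kronecker1 (x : cohomology1) (z : homology1) : rat^o :=
  fglift (val (repr x)) (val (repr z)).

Definition kronecker2 (x : cohomology2) (z : homology2) : rat^o :=
  fglift (val (repr x)) (val (repr z)).

Lemma fglift_cobar1 (c : G -> rat^o) (z : {freeg (G * G) / rat}) :
  fglift (cobar1 c) z = fglift c (bar2 z).
Proof.
rewrite fglift_sum /bar2 (fglift_sum _ z) linear_sum; apply: eq_bigr => p _.
rewrite linearZ; congr (_ *: _).
by rewrite /= linearD linearB /= !fgliftU.
Qed.

Lemma fglift_cobar2 (c : G * G -> rat^o) (z : {freeg (G * G * G) / rat}) :
  fglift (cobar2 c) z = fglift c (bar3 z).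
Proof.
rewrite fglift_sum /bar3 (fglift_sum _ z) linear_sum; apply: eq_bigr => -[[g h] k] _.
rewrite linearZ; congr (_ *: _).
by rewrite /= linearB linearD linearB /= !fgliftU.
Qed.

Lemma fglift_funB (X : choiceType) (c d : X -> rat^o) (z : {freeg X / rat}) :
  fglift (c - d) z = fglift c z - fglift d z.
Proof.
rewrite !fglift_sum -sumrB; apply: eq_bigr => x _.
by rewrite -scalerBr.
Qed.

(* H^1 is the space of homomorphisms from G to Q: there are no coboundaries. *)
Lemma cohomology1_repr (a : kermod cobar1) :
  repr (quotmod_pi (boundaries cobar0 cobar1) a) = a.
Proof.
have [c cE] := quotmod_repr (boundaries cobar0 cobar1) a.
apply/esym/eqP; rewrite -subr_eq0; apply/eqP/val_inj; rewrite cE.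
by rewrite linear0.
Qed.

Lemma kronecker1E (a : kermod cobar1) (z : kermod bar1) :
  kronecker1 (quotmod_pi _ a) (quotmod_pi _ z) = fglift (val a) (val z).
Proof.
rewrite /kronecker1 cohomology1_repr; set z' := repr _.
have [w zw] : boundaries bar2 bar1 (z - z') by exact: quotmod_repr.
apply/esym/eqP; rewrite -subr_eq0 -(linearB (fglift (val a))).
have -> : val z - val z' = bar2 w by rewrite -zw linearB.
rewrite /= -fglift_cobar1; case: a => c /= /eqP ->.
by rewrite fglift_sum big1 // => x _; rewrite scaler0.
Qed.

Lemma kronecker2E (c : kermod cobar2) (z : kermod bar2) :
  kronecker2 (quotmod_pi _ c) (quotmod_pi _ z) = fglift (val c) (val z).
Proof.
rewrite /kronecker2; set c' := repr _; set z' := repr _.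
have zz' : fglift (val c) (val z) = fglift (val c) (val z').
  have [w zw] : boundaries bar3 bar2 (z - z') by exact: quotmod_repr.
  apply/eqP; rewrite -subr_eq0 -(linearB (fglift (val c))).
  have -> : val z - val z' = bar3 w by rewrite -zw linearB.
  rewrite /= -fglift_cobar2; case: (c) => d /= /eqP ->.
  by rewrite fglift_sum big1 // => x _; rewrite scaler0.
rewrite zz'; apply/esym/eqP; rewrite -subr_eq0 -fglift_funB.
have [w cw] := quotmod_repr (boundaries cobar1 cobar2) c.
have -> : val c - val c' = cobar1 w by rewrite -cw linearB.
by rewrite fglift_cobar1; case: (z') => z0 /= /eqP ->; rewrite linear0.
Qed.

Lemma cocycle1M (a : kermod cobar1) g h : val a (g * h)%g = val a g + val a h.
Proof.
case: a => a /= /eqP /(congr1 (fun c => c (g, h))); rewrite /cobar1 /= => E.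
have F (u v w : rat) : u - w + v = 0 -> w = v + u.
  by move=> uvw; rewrite -[LHS]addr0 -uvw; ring.
exact: F E.
Qed.

Definition cup_cochain (a b : G -> rat^o) : G * G -> rat^o :=
  fun p => a p.1 * b p.2.

Fact cup_cocycle (a b : kermod cobar1) :
  in_ker cobar2 (cup_cochain (val a) (val b)).
Proof.
apply/eqP/funext => -[[g h] k]; rewrite /cobar2 /cup_cochain /= !cocycle1M.
have E (x y z t : rat) : y * t - (x + y) * t + x * (z + t) - x * z = 0 by ring.
exact: E.
Qed.

Definition cup_ker (a b : kermod cobar1) : kermod cobar2 :=
  Kermod (cup_cocycle a b).

Definition cup (x y : cohomology1) : cohomology2 :=
  quotmod_pi _ (cup_ker (repr x) (repr y)).

Lemma cupE (a b : kermod cobar1) :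
  cup (quotmod_pi _ a) (quotmod_pi _ b) = quotmod_pi _ (cup_ker a b).
Proof. by rewrite /cup !cohomology1_repr. Qed.

Lemma cohomology1_surj (x : cohomology1) : exists a, x = quotmod_pi _ a.
Proof. exact: quotmod_surj. Qed.

Lemma cup_linearl y : linear (cup^~ y).
Proof.
move=> t x x'; have [{}x ->] := cohomology1_surj x.
have [{}x' ->] := cohomology1_surj x'; have [{}y ->] := cohomology1_surj y.
rewrite -linearP !cupE -linearP; congr quotmod_pi; apply: val_inj.
apply/funext => p /=; rewrite /cup_cochain !fctE /=.
have E (u v w : rat) : (t * u + v) * w = t * (u * w) + v * w by ring.
exact: E.
Qed.

Lemma cup_linearr y : linear (cup y).
Proof.
move=> t x x'; have [{}x ->] := cohomology1_surj x.
have [{}x' ->] := cohomology1_surj x'; have [{}y ->] := cohomology1_surj y.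
rewrite -linearP !cupE -linearP; congr quotmod_pi; apply: val_inj.
apply/funext => p /=; rewrite /cup_cochain !fctE /=.
have E (u v w : rat) : w * (t * u + v) = t * (w * u) + w * v by ring.
exact: E.
Qed.

(* a(g) a(h) is the coboundary of - a^2 / 2. *)
Lemma cup_alt x : cup x x = 0.
Proof.
have [{}x ->] := cohomology1_surj x; rewrite cupE; apply/quotmod_pi_eq0.
exists (fun g => - (val x g ^+ 2 / 2%:R)); apply/funext => -[g h] /=.
rewrite /cup_cochain /cobar1 /= cocycle1M.
have E (u v : rat) : u * v = - (v ^+ 2 / 2%:R) - - ((u + v) ^+ 2 / 2%:R)
  + - (u ^+ 2 / 2%:R) by field.
exact: E.
Qed.

Definition cup_map : ext2 cohomology1 -> cohomology2 := ext2_lift cup.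

Lemma cup_map_linear : linear cup_map.
Proof. exact: ext2_lift_linear cup_linearl cup_linearr cup_alt. Qed.

Lemma cup_map_wedge x y : cup_map (wedge x y) = cup x y.
Proof. exact: ext2_lift_wedge cup_linearl cup_linearr cup_alt _ _. Qed.

(* The pairing of the exterior squares of H^1 and H_1 with
   <a /\ b, v /\ w> = <a, v> <b, w> - <a, w> <b, v>. *)
Definition kronecker_ext2 (x : ext2 cohomology1) (w : ext2 homology1) : rat^o :=
  ext2_lift (fun a b => ext2_lift (fun u v =>
    kronecker1 a u * kronecker1 b v - kronecker1 a v * kronecker1 b u) w) x.

Lemma kronecker1_linearl z : linear (kronecker1^~ z).
Proof.
move=> t x y; have [{}x ->] := cohomology1_surj x.
have [{}y ->] := cohomology1_surj y; have [{}z ->] := quotmod_surj z.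
rewrite -linearP -/(quotmod_pi _ _) !kronecker1E !fglift_sum scaler_sumr.
rewrite -big_split; apply: eq_bigr => g _.
rewrite /= !fctE scalerDr; congr (_ + _).
by rewrite !scalerA mulrC.
Qed.

Lemma kronecker1_linearr x : linear (kronecker1 x).
Proof.
move=> t z w; have [{}x ->] := cohomology1_surj x.
have [{}z ->] := quotmod_surj z; have [{}w ->] := quotmod_surj w.
by rewrite -!/(quotmod_pi _ _) -linearP !kronecker1E !linearP.
Qed.

Section ExteriorPairing.

Let det a b u v : rat^o :=
  kronecker1 a u * kronecker1 b v - kronecker1 a v * kronecker1 b u.

Let det_linearl a b v : linear (det a b ^~ v).
Proof.
move=> t u u'; rewrite /det !kronecker1_linearr.
have E (x x' y z z' w : rat) : (t * x + x') * y - w * (t * z + z')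
  = t * (x * y - w * z) + (x' * y - w * z') by ring.
exact: E.
Qed.

Let det_linearr a b u : linear (det a b u).
Proof.
move=> t v v'; rewrite /det !kronecker1_linearr.
have E (x x' y z z' w : rat) : y * (t * x + x') - (t * z + z') * w
  = t * (y * x - z * w) + (y * x' - z' * w) by ring.
exact: E.
Qed.

Let det_alt a b u : det a b u u = 0.
Proof. by rewrite /det subrr. Qed.

Let lift_pi a b := ext2_lift_pi (det_linearl a b) (det_linearr a b) (det_alt a b).

Let lift_linearl w b : linear (fun a => ext2_lift (det a b) w).
Proof.
have [{}w ->] := quotmod_surj w.
move=> t a a'; rewrite -!/(quotmod_pi _ _) !lift_pi !fglift_sum scaler_sumr.
rewrite -big_split; apply: eq_bigr => -[u v] _ /=.
rewrite /det !kronecker1_linearl.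
have E (c x x' y z z' y' : rat) : c * ((t * x + x') * y - (t * z + z') * y')
  = t * (c * (x * y - z * y')) + c * (x' * y - z' * y') by ring.
exact: E.
Qed.

Let lift_linearr w a : linear (fun b => ext2_lift (det a b) w).
Proof.
have [{}w ->] := quotmod_surj w.
move=> t b b'; rewrite -!/(quotmod_pi _ _) !lift_pi !fglift_sum scaler_sumr.
rewrite -big_split; apply: eq_bigr => -[u v] _ /=.
rewrite /det !kronecker1_linearl.
have E (c x x' y z z' y' : rat) : c * (y * (t * x + x') - y' * (t * z + z'))
  = t * (c * (y * x - y' * z)) + c * (y * x' - y' * z') by ring.
exact: E.
Qed.

Let lift_alt w a : ext2_lift (det a a) w = 0.
Proof.
have [{}w ->] := quotmod_surj w.
rewrite -!/(quotmod_pi _ _) lift_pi fglift_sum big1 // => -[u v] _ /=.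
by rewrite /det [X in _ - X]mulrC subrr scaler0.
Qed.

Lemma kronecker_ext2_linearl w : linear (kronecker_ext2^~ w).
Proof.
exact: (ext2_lift_linear (lift_linearl w) (lift_linearr w) (lift_alt w)).
Qed.

Lemma kronecker_ext2_linearr x : linear (kronecker_ext2 x).
Proof.
have [{}x ->] := quotmod_surj x; move=> t w w'.
rewrite -!/(quotmod_pi _ _) /kronecker_ext2.
rewrite !(ext2_lift_pi (lift_linearl _) (lift_linearr _) (lift_alt _)).
rewrite !fglift_sum scaler_sumr -big_split; apply: eq_bigr => -[a b] _ /=.
rewrite (ext2_lift_linear (@det_linearl a b) (@det_linearr a b) (@det_alt a b)).
by rewrite scalerDr !scalerA [t * _]mulrC.
Qed.

Lemma kronecker_ext2_wedge a b u v :
  kronecker_ext2 (wedge a b) (wedge u v)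
  = kronecker1 a u * kronecker1 b v - kronecker1 a v * kronecker1 b u.
Proof.
rewrite /kronecker_ext2.
rewrite (ext2_lift_wedge (lift_linearl _) (lift_linearr _) (lift_alt _)).
exact: (ext2_lift_wedge (@det_linearl a b) (@det_linearr a b) (@det_alt a b)).
Qed.

End ExteriorPairing.

(* The dual H_2 -> H_1 /\ H_1 of the cup product.  If G is finitely generated,
   then kronecker_ext2 is a perfect pairing, so that cup_dual z is the unique
   element with <x, cup_dual z> = <cup_map x, z> for all x. *)
Definition cup_dual (z : homology2) : ext2 homology1 :=
  xget 0 [set w | forall x : ext2 cohomology1,
    kronecker_ext2 x w = kronecker2 (cup_map x) z].

End GroupHomology.

(* The identification of V /\ V with the degree 2 part of the free Lie algebra,
   sending v /\ w to [v, w]. *)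
Definition ext2_free_lie (K : comNzRingType) (V : lmodType K) :
    ext2 V -> free_lie V :=
  ext2_lift (fun v w => lie (free_lie_gen v) (free_lie_gen w)).

Lemma ext2_free_lie_wedge (K : comNzRingType) (V : lmodType K) (v w : V) :
  ext2_free_lie (wedge v w) = lie (free_lie_gen v) (free_lie_gen w).
Proof.
apply: ext2_lift_wedge => [x a y z|x a y z|x]; last exact: liexx.
  by rewrite linearP lie_linearl.
by rewrite linearP lie_linearr.
Qed.

Lemma ext2_free_lie_piece (K : comNzRingType) (V : lmodType K) (x : ext2 V) :
  graded_piece 2 (ext2_free_lie x).
Proof.
rewrite /graded_piece /ext2_free_lie /ext2_lift /= fglift_sum linear_sum.
apply: eq_bigr => p _; rewrite linearZ /=; congr (_ *: _).
by apply: (@homog_lie _ _ 1 1); apply: free_lie_gen_piece.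
Qed.

Section Holonomy.
Variable G : groupType.

Definition holonomy_relations : set (free_lie (homology1 G)) :=
  [set ext2_free_lie (cup_dual z) | z in [set: homology2 G]].

Fact holonomy_relations_homog x :
  holonomy_relations x -> exists n, graded_piece n x.
Proof. by move=> [z _ <-]; exists 2%N; apply: ext2_free_lie_piece. Qed.

Definition holonomy := lie_quot (graded_ideal_gen holonomy_relations_homog).
HB.instance Definition _ := GradedLie.on holonomy.

End Holonomy.

(* Main.v *)
(* The dual of the cup product has an explicit form on chains: since the
   symmetrized cup product of two 1-cocycles is a coboundary, the class of a
   2-cycle z = sum c (g, h) is sent to 1/2 sum c [g] /\ [h], and no other element
   of the exterior square has the same pairings because H_1 is finite-dimensional.
   Hence the holonomy relations are the elements sum c [[g], [h]], z ranging over
   the 2-cycles.  Let N lie in the kernel of G -> H_1(G; Q), so that H_1 does not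
   see the difference between G and G / N.  A 2-cycle of G / N lifts to a chain of
   G whose boundary is spanned by the elements g - g n; up to the boundary of
   (g, n), which contributes nothing as [n] = 0, this is a combination of elements
   n of N.  If N is contained in the second derived subgroup, then n is itself the
   boundary of a chain with zero contribution, so that G and G / N have the same
   relations.  If G / N is abelian, the cycles (g, h) - (h, g) show that all
   brackets of degree 2 are relations. *)
From HB Require Import structures.
From mathcomp Require Import all_boot all_order all_algebra.
From mathcomp Require Import freeg.
From mathcomp Require Import ring.
From mathcomp Require Import boolp classical_sets functions.
Require Import Defs.

Set Implicit Arguments.
Unset Strict Implicit.
Unset Printing Implicit Defensive.

Import GRing.Theory.
Local Open Scope classical_set_scope.
Local Open Scope ring_scope.

(** * Quotients and functoriality of graded Lie algebras *)

Lemma rat_half (V : lmodType rat) (v : V) : (2%:R : rat)^-1 *: (v + v) = v.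
Proof. by rewrite -mulr2n -scaler_nat scalerA mulVf // scale1r. Qed.

Section LieQuotientPi.
Variables (K : comNzRingType) (L : gradedLieType K) (I : graded_ideal L).

(** The projection [quotmod_pi], retyped with values in [lie_quot I] so that the bracket and the
    grading of the quotient are found on them. *)
Definition lie_quot_pi : L -> lie_quot I := quotmod_pi I.
HB.instance Definition _ := GRing.Linear.on lie_quot_pi.

Lemma lie_quot_pi_homog n : {morph lie_quot_pi : x / homog n x >-> homog n x}.
Proof. by move=> x; apply/esym/lie_quot_homogE. Qed.

Lemma lie_quot_pi_lie : {morph lie_quot_pi : x y / lie x y >-> lie x y}.
Proof. by move=> x y; apply/esym/lie_quot_lieE. Qed.

Lemma lie_quot_pi_surj x : exists y, x = lie_quot_pi y.
Proof. exact: lie_quot_surj. Qed.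

Lemma lie_quot_pi_eq0 x : lie_quot_pi x = 0 <-> I x.
Proof. exact: quotmod_pi_eq0. Qed.

End LieQuotientPi.

Arguments lie_quot_pi {K L} I x.

Section LieIsomorphism.
Variables (K : comNzRingType) (L M : gradedLieType K) (I : graded_ideal L).
Variable p : {linear L -> M}.
Hypothesis plie : {morph p : x y / lie x y >-> lie x y}.
Hypothesis phomog : forall n, {morph p : x / homog n x >-> homog n x}.
Hypothesis psurj : forall y, exists x, y = p x.
Hypothesis pker : forall x, p x = 0 <-> I x.

Definition lie_quot_lift (x : lie_quot I) : M := p (repr x).

Lemma lie_quot_liftE x : lie_quot_lift (lie_quot_pi I x) = p x.
Proof.
apply/esym/eqP; rewrite -subr_eq0 -linearB; apply/eqP/pker.
exact: quotmod_repr.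
Qed.

Fact lie_quot_lift_linear : linear lie_quot_lift.
Proof.
move=> a x y; have [{}x ->] := lie_quot_pi_surj x; have [{}y ->] := lie_quot_pi_surj y.
by rewrite -linearP !lie_quot_liftE linearP.
Qed.

HB.instance Definition _ := GRing.isLinear.Build K (lie_quot I) M _
  lie_quot_lift lie_quot_lift_linear.

Lemma first_isomorphism : graded_lie_isomorphic (lie_quot I) M.
Proof.
pose phi : {linear lie_quot I -> M} := lie_quot_lift.
have phihomog n x : phi (homog n x) = homog n (phi x).
  have [{}x ->] := lie_quot_pi_surj x.
  by rewrite /phi /= -lie_quot_pi_homog !lie_quot_liftE phomog.
have phiinj : injective phi.
  move=> x y; have [{}x ->] := lie_quot_pi_surj x; have [{}y ->] := lie_quot_pi_surj y.
  rewrite /phi /= !lie_quot_liftE => /eqP; rewrite -subr_eq0 -linearB => /eqP.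
  by move=> /pker xy; apply/quotmod_piP.
have phisurj y : exists x, y = phi x.
  by have [x ->] := psurj y; exists (lie_quot_pi I x); rewrite /phi /= lie_quot_liftE.
exists phi; split.
- have [psi psiE] := choice phisurj; exists psi => x //; apply: phiinj.
  exact/esym/psiE.
- move=> x y; have [{}x ->] := lie_quot_pi_surj x; have [{}y ->] := lie_quot_pi_surj y.
  by rewrite -lie_quot_pi_lie /phi /= !lie_quot_liftE plie.
- move=> n; apply/seteqP; split=> [_ [x xn <-]|y yn].
    by rewrite /graded_piece /= -phihomog xn.
  (* A preimage of a homogeneous element is homogeneous, since [phi] is injective and commutes with
     the projections. *)
  have [x yx] := phisurj y; exists x => //; apply: phiinj.
  by rewrite phihomog -yx yn.
Qed.

End LieIsomorphism.

(** Elements are classes of terms, so this is induction on terms; the linear constructors are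
    absorbed by [W] being a submodule. *)
Lemma free_lie_ind (K : comNzRingType) (V : lmodType K)
    (W : submodule (free_lie V)) :
  (forall v, W (free_lie_gen v)) ->
  (forall x y, W x -> W y -> W (lie x y)) -> forall x, W x.
Proof.
move=> Wgen Wlie x; have [t ->] := free_lie_surj x.
elim: t => [v||s IH|s IHs t IHt|a s IH|s IHs t IHt].
- exact: Wgen.
- exact: submodule0.
- by rewrite -free_lie_opprE; apply: submoduleN.
- by rewrite -free_lie_addrE; apply: submoduleD.
- by rewrite -free_lie_scalerE; apply: submoduleZ.
- by rewrite -free_lie_lierE; apply: Wlie.
Qed.

Section FreeLieMap.
Variables (K : comNzRingType) (V W : lmodType K) (f : {linear V -> W}).

Definition free_lie_map : {linear free_lie V -> free_lie W} :=
  free_lie_lift (@free_lie_gen K W \o f).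

Lemma free_lie_map_gen v : free_lie_map (free_lie_gen v) = free_lie_gen (f v).
Proof. exact: (free_lie_lift_gen (@free_lie_gen K W \o f)). Qed.

Lemma free_lie_map_lie : {morph free_lie_map : x y / lie x y >-> lie x y}.
Proof. exact: (free_lie_lift_lie (@free_lie_gen K W \o f)). Qed.

Lemma free_lie_map_homog n : {morph free_lie_map : x / homog n x >-> homog n x}.
Proof.
pose T : set (free_lie V) :=
  [set x | forall n, free_lie_map (homog n x) = homog n (free_lie_map x)].
have T0 : T 0 by move=> m; rewrite !linear0.
have TP a u v : T u -> T v -> T (a *: u + v).
  by move=> Tu Tv m; rewrite !linearP Tu Tv.
move=> x; apply: (@free_lie_ind _ _ (Submodule T0 TP)) => {n x} [v|x y Tx Ty] m.
  rewrite free_lie_map_gen; have [->|m1] := eqVneq m 1%N.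
    by rewrite !free_lie_gen_piece free_lie_map_gen.
  by rewrite !(homog_piece_neq (free_lie_gen_piece _) m1) linear0.
rewrite free_lie_map_lie [homog m (lie x y)](free_lie_homog_conv m x y).
rewrite [RHS](free_lie_homog_conv m) /lie_conv linear_sum.
apply: eq_bigr => i _; rewrite linear_sum; apply: eq_bigr => j _ /=.
by case: ifP => _; rewrite ?linear0 // free_lie_map_lie; congr lie; [apply: Tx|apply: Ty].
Qed.

End FreeLieMap.

Lemma free_lie_mapK (K : comNzRingType) (V W : lmodType K)
    (f : {linear V -> W}) (g : {linear W -> V}) :
  cancel f g -> cancel (free_lie_map f) (free_lie_map g).
Proof.
move=> fK; pose T : set (free_lie V) :=
  [set x | free_lie_map g (free_lie_map f x) = x].
have T0 : T 0 by rewrite /T /= !linear0.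
have TP a u v : T u -> T v -> T (a *: u + v).
  by move=> Tu Tv; rewrite /T /= !linearP Tu Tv.
apply: (@free_lie_ind _ _ (Submodule T0 TP)) => [v|x y Tx Ty].
  by rewrite /= /T /= !free_lie_map_gen fK.
by rewrite /= /T /= !free_lie_map_lie Tx Ty.
Qed.

(** Two inductions, first on the right argument with a generator on the left, then on the left
    argument. The Jacobi identity drives the first; the second uses only antisymmetry and the ideal
    property. *)
Lemma ideal_contains_brackets (K : comNzRingType) (V : lmodType K)
    (I : lie_ideal (free_lie V)) :
  (forall v w, I (lie (free_lie_gen v) (free_lie_gen w))) ->
  forall x y, I (lie x y).
Proof.
move=> Igen.
have Igenl v x : I (lie (free_lie_gen v) x).
  pose T : set (free_lie V) := [set x | I (lie (free_lie_gen v) x)].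
  have T0 : T 0 by rewrite /T /= linear0; apply: submodule0.
  have TP a y z : T y -> T z -> T (a *: y + z).
    by move=> Ty Tz; rewrite /T /= linearP; apply: submoduleP.
  apply: (@free_lie_ind _ _ (Submodule T0 TP)) => [w|y z Ty Tz]; first exact: Igen.
  have := lie_jacobi (free_lie_gen v) y z; rewrite /= /T /= -addrA => /eqP.
  rewrite addr_eq0 => /eqP ->; apply/submoduleN/submoduleD.
    by rewrite [lie z _]lieC linearN; apply/submoduleN/lie_idealP.
  exact: lie_idealP.
move=> x y.
pose T : set (free_lie V) := [set x | forall y, I (lie x y)].
have T0 : T 0 by move=> z; rewrite lie0l; apply: submodule0.
have TP a u v : T u -> T v -> T (a *: u + v).
  by move=> Tu Tv z; rewrite lie_linearl; apply: submoduleP.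
apply: (@free_lie_ind _ _ (Submodule T0 TP)) => [v z|u v Tu _ z]; first exact: Igenl.
by rewrite lieC; apply/submoduleN/lie_idealP.
Qed.

(** * Linear algebra: dual frames, and linear maps determined on generators *)

Definition linear_pack (K : nzRingType) (V M : lmodType K) (f : V -> M)
    (f_lin : linear f) : {linear V -> M} :=
  HB.pack_for {linear V -> M} f (GRing.isLinear.Build K V M _ f f_lin).

Definition spanning (K : fieldType) (V : lmodType K) n (e : 'I_n -> V) : Prop :=
  forall v, exists c : 'I_n -> K, v = \sum_i c i *: e i.

(** A spanning family of minimal size is free, so coordinates with respect to it are unique, and
    therefore linear. *)
Lemma spanning_dual_frame (K : fieldType) (V : lmodType K) n (e : 'I_n -> V) :
  spanning e ->
  exists m (b : 'I_m -> V) (phi : 'I_m -> {linear V -> K^o}),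
    forall v, v = \sum_i (phi i v : K) *: b i.
Proof.
move=> e_span.
pose spans m := `[< exists b : 'I_m -> V, spanning b >].
have [m /asboolP[b b_span] m_min] :=
  ex_minnP (ex_intro spans n (asboolT (ex_intro _ e e_span))).
have b_free (c : 'I_m -> K) : \sum_i c i *: b i = 0 -> forall i, c i = 0.
  move=> c0 k; apply/eqP; apply: contraT => ck.
  case: m b b_span m_min c c0 k ck => [|m] b b_span m_min c c0 k ck.
    by case: k {ck}.
  have : spans m; last by move/m_min; rewrite ltnn.
  (* As [c k] is nonzero, [b k] is a combination of the other vectors; substituting it into the
     expansion of [v] gives the new coordinates. *)
  apply/asboolP; exists (fun j => b (fintype.lift k j)) => v; have [d ->] := b_span v.
  exists (fun j => d (fintype.lift k j) - d k / c k * c (fintype.lift k j)).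
  have bk : b k = - (c k)^-1 *: \sum_j c (fintype.lift k j) *: b (fintype.lift k j).
    move: c0; rewrite (bigD1_ord k) //= => /eqP; rewrite addr_eq0 => /eqP ckbk.
    by rewrite scaleNr -scalerN -ckbk scalerA mulVf // scale1r.
  rewrite (bigD1_ord k) //= {1}bk scaleNr scalerN scalerA scaler_sumr addrC -sumrB.
  by apply: eq_bigr => j _; rewrite scalerA scalerBl.
have [c cE] := choice b_span.
have c_lin i : linear (fun v => c v i : K^o).
  move=> a u v; apply/eqP; rewrite -subr_eq0; apply/eqP.
  apply: (b_free (fun i => c (a *: u + v) i - (a * c u i + c v i))).
  under eq_bigr => j _ do rewrite scalerBl scalerDl -scalerA.
  by rewrite sumrB big_split -scaler_sumr -!cE subrr.
exists m, b, (fun i => linear_pack (c_lin i)).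
exact: cE.
Qed.

(** Linearity is a hypothesis rather than a structure, so that arbitrary expressions in the chain
    can be compared. *)
Lemma freeg_ext (K : nzRingType) (X : choiceType) (M : lmodType K)
    (f g : {freeg X / K} -> M) : linear f -> linear g ->
  (forall x, f << x >> = g << x >>) -> f =1 g.
Proof.
move=> f_lin g_lin fg z.
rewrite -[f]/(linear_pack f_lin : _ -> _) -[g]/(linear_pack g_lin : _ -> _).
rewrite -(freeg_sumE z) !linear_sum; apply: eq_bigr => x _.
have -> : << coeff x z *g x >> = coeff x z *: << x >> :> {freeg X / K}.
  by apply/eqP/freeg_eqP => y; rewrite coeffZ !coeffU mul1r.
by rewrite !linearZ /= fg.
Qed.

Lemma freeg_ind (K : nzRingType) (X : choiceType) (W : submodule {freeg X / K}) :
  (forall x, W << x >>) -> forall z, W z.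
Proof.
move=> WX z; have -> : z = \sum_(x <- dom z) coeff x z *: << x >>.
  transitivity (fglift (fun x : X => << x >> : {freeg X / K}) z); last exact: fglift_sum.
  by move: z; apply: freeg_ext => [||x]; [by []|exact: linearP|rewrite fgliftU].
by apply: submodule_sum => x _; apply: submoduleZ.
Qed.

Lemma ext2_ext (K : nzRingType) (V M : lmodType K) (f g : ext2 V -> M) :
  linear f -> linear g ->
  (forall u v, f (wedge u v) = g (wedge u v)) -> f =1 g.
Proof.
move=> f_lin g_lin fg x; have [{}x ->] := quotmod_surj x.
pose p : {linear _ -> ext2 V} := quotmod_pi (span (@ext2_relator K V)).
apply: (@freeg_ext _ _ _ (f \o p) (g \o p)) => [a y z|a y z|[u v]].
- by rewrite /= linearP f_lin.
- by rewrite /= linearP g_lin.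
- exact: fg.
Qed.

(** * Rational homology in degree one *)

Section FirstHomology.
Variable G : groupType.

(** The differential out of degree 1 is zero, so every 1-chain has a homology class. *)
Lemma bar1_cycle (z : {freeg G / rat}) : in_ker (@bar1 G) z.
Proof.
by apply/eqP; rewrite /= /bar1 fglift_sum big1 // => g _; rewrite scaler0.
Qed.

Definition chain_class (z : {freeg G / rat}) : homology1 G :=
  quotmod_pi (boundaries (@bar2 G) (@bar1 G)) (Kermod (bar1_cycle z)).

Fact chain_class_linear : linear chain_class.
Proof.
move=> a x y; rewrite /chain_class -linearP.
by congr quotmod_pi; apply: val_inj.
Qed.

HB.instance Definition _ := GRing.isLinear.Build rat {freeg G / rat}
  (homology1 G) _ chain_class chain_class_linear.

Definition group_class (g : G) : homology1 G := chain_class << g >>.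

Lemma chain_class_surj x : exists z, x = chain_class z.
Proof.
have [{}x ->] := quotmod_surj x; exists (val x).
apply: (congr1 (quotmod_pi (boundaries (@bar2 G) (@bar1 G)))).
exact: val_inj.
Qed.

Lemma chain_class_eq0 z : chain_class z = 0 <-> exists w, z = bar2 w.
Proof. exact: quotmod_pi_eq0. Qed.

Lemma chain_classE : chain_class =1 fglift group_class.
Proof.
by apply: freeg_ext => [||g]; [exact: linearP|exact: linearP|rewrite fgliftU].
Qed.

Lemma bar2U (g h : G) :
  bar2 << (g, h) >> = << h >> - << (g * h)%g >> + << g >>.
Proof. exact: fgliftU. Qed.

Lemma group_classM : {morph group_class : g h / (g * h)%g >-> g + h}.
Proof.
move=> g h; have : chain_class (<< g >> + << h >> - << (g * h)%g >>) = 0.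
  apply/chain_class_eq0; exists << (g, h) >>.
  by rewrite bar2U [RHS]addrC addrA.
by rewrite linearB linearD => /eqP; rewrite subr_eq0 => /eqP/esym.
Qed.

Section Additive.
Variables (M : lmodType rat) (c : G -> M).
Hypothesis cM : {morph c : g h / (g * h)%g >-> g + h}.

Lemma fglift_bar2 w : fglift c (bar2 w) = 0.
Proof.
apply: (@freeg_ext _ _ _ (fglift c \o @bar2 G) (fun=> 0)) => [a y z|a y z|[g h]].
- by rewrite /= !linearP.
- by rewrite scaler0 addr0.
rewrite /= bar2U linearD linearB /= !fgliftU cM opprD.
by rewrite addrCA subrr addr0 addNr.
Qed.

(** The universal property of H_1: homomorphisms to a rational vector space extend to it. By
    [fglift_bar2] the choice of representative does not matter. *)
Definition homology1_lift (x : homology1 G) : M := fglift c (val (repr x)).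

Lemma homology1_liftE z : homology1_lift (chain_class z) = fglift c z.
Proof.
have [w zw] : boundaries (@bar2 G) (@bar1 G)
    (Kermod (bar1_cycle z) - repr (chain_class z)) by exact: quotmod_repr.
apply/esym/eqP; rewrite -subr_eq0 /homology1_lift -(linearB (fglift c)) /=.
have -> : z - val (repr (chain_class z)) = bar2 w by rewrite -zw linearB.
by apply/eqP/fglift_bar2.
Qed.

Fact homology1_lift_linear : linear homology1_lift.
Proof.
move=> a x y; have [{}x ->] := chain_class_surj x.
have [{}y ->] := chain_class_surj y.
by rewrite -linearP !homology1_liftE linearP.
Qed.

Lemma homology1_lift_class g : homology1_lift (group_class g) = c g.
Proof. by rewrite homology1_liftE fgliftU. Qed.

Definition trivial_on : set G := [set g | c g = 0].

Lemma additive1 : c 1%g = 0.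
Proof. by apply: (addrI (c 1%g)); rewrite -cM mulg1 addr0. Qed.

Lemma additiveV g : c g^-1%g = - c g.
Proof. by apply/eqP; rewrite -addr_eq0 -cM mulVg additive1. Qed.

(** The kernel of a homomorphism to an abelian group is a subgroup containing all commutators. *)
Lemma additive_derived i : @derived_set G i.+1 `<=` trivial_on.
Proof.
have T1 : trivial_on 1%g by exact: additive1.
have TM x y : trivial_on x -> trivial_on y -> trivial_on (x * y)%g.
  by rewrite /trivial_on /= cM => -> ->; rewrite addr0.
have TV x : trivial_on x -> trivial_on x^-1%g.
  by rewrite /trivial_on /= additiveV => ->; rewrite oppr0.
move=> g Dg; apply: (Dg (Subgroup T1 TM TV)) => _ [x [y [_ _ ->]]].
rewrite /= /trivial_on /= commgEl /conjg !cM !additiveV.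
by rewrite addrA -opprD addNr.
Qed.

End Additive.

Lemma homology1_ext (M : lmodType rat) (f g : homology1 G -> M) :
  linear f -> linear g ->
  (forall x, f (group_class x) = g (group_class x)) -> f =1 g.
Proof.
move=> f_lin g_lin fg x; have [z ->] := chain_class_surj x.
apply: (@freeg_ext _ _ _ (f \o chain_class) (g \o chain_class)) => [a y t|a y t|y].
- by rewrite /= linearP f_lin.
- by rewrite /= linearP g_lin.
- exact: fg.
Qed.

(** The group elements whose class is a combination of the classes of the generators form a
    subgroup. *)
Lemma finitely_generated_spanning : finitely_generated G ->
  exists n (e : 'I_n -> homology1 G), spanning e.
Proof.
move=> [s sG]; exists (size s), (fun i => group_class (tnth (in_tuple s) i)).
set e := fun i => _.
pose T : set (homology1 G) := [set v | exists c : _ -> rat, v = \sum_i c i *: e i].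
have T0 : T 0.
  by exists (fun=> 0); rewrite big1 // => i _; rewrite scale0r.
have TP a u v : T u -> T v -> T (a *: u + v).
  move=> [c ->] [d ->]; exists (fun i => a * c i + d i).
  rewrite scaler_sumr -big_split; apply: eq_bigr => i _.
  by rewrite scalerDl scalerA.
pose W := Submodule T0 TP.
suff Wg g : W (group_class g).
  move=> v; have [z ->] := chain_class_surj v; rewrite chain_classE fglift_sum.
  by apply: (@submodule_sum _ _ W) => g _; apply: submoduleZ.
have W1 : W (group_class 1%g) by rewrite (additive1 group_classM).
have WM x y : W (group_class x) -> W (group_class y) -> W (group_class (x * y)%g).
  by rewrite group_classM; apply: submoduleD.
have WV x : W (group_class x) -> W (group_class x^-1%g).
  by rewrite (additiveV group_classM); apply: submoduleN.
apply: (sG g (@Subgroup _ [set g | W (group_class g)] W1 WM WV)) => x /= xs.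
have [i <-] : exists i, tnth (in_tuple s) i = x.
  by have /tnthP[i ->] : x \in in_tuple s by []; exists i.
exists (fun j => (j == i)%:R); rewrite (bigD1 i) //= eqxx scale1r big1 ?addr0 //.
by move=> j /negPf ->; rewrite scale0r.
Qed.

End FirstHomology.

(** * The dual of the cup product *)

Section Wedge.
Variables (K : nzRingType) (V : lmodType K).

HB.instance Definition _ (v : V) :=
  GRing.isLinear.Build K V (ext2 V) _ (wedge v) (@wedge_linearr K V v).

Lemma wedgeC (u v : V) : wedge u v = - wedge v u.
Proof.
have wD w : wedge (u + v) w = wedge u w + wedge v w.
  exact: (linearD (linear_pack (wedge_linearl w))).
have := wedge_alt (u + v); rewrite linearD /= !wD !wedge_alt add0r addr0 addrC.
by move=> /eqP; rewrite addr_eq0 => /eqP.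
Qed.

Lemma wedge_suml (I : Type) (r : seq I) (c : I -> K) (b : I -> V) v :
  wedge (\sum_(i <- r) c i *: b i) v = \sum_(i <- r) c i *: wedge (b i) v.
Proof.
rewrite -[wedge _ v]/(linear_pack (wedge_linearl v) _) linear_sum.
by apply: eq_bigr => i _; rewrite linearZ.
Qed.

Lemma wedge_sumr (I : Type) (r : seq I) (c : I -> K) (b : I -> V) v :
  wedge v (\sum_(i <- r) c i *: b i) = \sum_(i <- r) c i *: wedge v (b i).
Proof. by rewrite linear_sum; apply: eq_bigr => i _; rewrite linearZ. Qed.

End Wedge.

Section CupDual.
Variable G : groupType.

Lemma kronecker1_class (a : kermod (@cobar1 G)) g :
  kronecker1 (quotmod_pi _ a) (group_class g) = val a g.
Proof. by rewrite kronecker1E fgliftU. Qed.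

(** A functional composed with [group_class] is a homomorphism, hence a 1-cocycle; thus H^1 is the
    full dual of H_1. *)
Lemma kronecker1_onto (phi : {linear homology1 G -> rat^o}) :
  exists x, forall z, kronecker1 x z = phi z.
Proof.
have c_cycle : in_ker (@cobar1 G) (phi \o @group_class G).
  apply/eqP/funext => -[g h]; rewrite /= /cobar1 /= group_classM linearD opprD.
  by rewrite addrCA subrr addr0 addNr.
exists (quotmod_pi _ (Kermod c_cycle)); apply: homology1_ext => [||g].
- exact: kronecker1_linearr.
- exact: linearP.
- by rewrite kronecker1_class.
Qed.

(** For a frame [b] with dual functionals represented by [a], the pairings of [w] with the wedges of
    the [a i] are twice its coefficients, up to symmetry, so they recover [w]. *)
Lemma kronecker_ext2_nondegenerate : finitely_generated G ->
  forall w w' : ext2 (homology1 G),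
    (forall x, kronecker_ext2 x w = kronecker_ext2 x w') -> w = w'.
Proof.
move=> /finitely_generated_spanning[n [e /spanning_dual_frame]].
move=> [m [b [phi frame]]].
have [a aE] := choice (fun i => kronecker1_onto (phi i)).
suff expand w : w = (2%:R : rat)^-1 *: \sum_i \sum_j
    (kronecker_ext2 (wedge (a i) (a j)) w : rat) *: wedge (b i) (b j).
  move=> w w' ww'; rewrite (expand w) (expand w'); congr (_ *: _).
  by apply: eq_bigr => i _; apply: eq_bigr => j _; rewrite ww'.
pose F w := (2%:R : rat)^-1 *: \sum_i \sum_j
    (kronecker_ext2 (wedge (a i) (a j)) w : rat) *: wedge (b i) (b j).
apply: (@ext2_ext _ _ _ id F) => {w} [//|t w w'|u v].
  rewrite /F scalerA mulrC -scalerA -scalerDr; congr (_ *: _).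
  rewrite scaler_sumr -big_split; apply: eq_bigr => i _.
  rewrite scaler_sumr -big_split; apply: eq_bigr => j _.
  by rewrite kronecker_ext2_linearr scalerDl scalerA.
have wE x y :
    wedge x y = \sum_i \sum_j (phi i x * phi j y : rat) *: wedge (b i) (b j).
  rewrite {1}(frame x) {1}(frame y) wedge_suml; apply: eq_bigr => i _.
  by rewrite wedge_sumr scaler_sumr; apply: eq_bigr => j _; rewrite scalerA.
(* Twice the wedge of [u] and [v] is that wedge minus the one of [v] and [u], which antisymmetrizes
   the coefficients into the determinant pairing. *)
rewrite /F -[LHS]rat_half; congr (_ *: _).
transitivity (\sum_i \sum_j
    (phi i u * phi j v - phi i v * phi j u : rat) *: wedge (b i) (b j)).
  rewrite /= {2}wedgeC (wE u v) (wE v u) -sumrB; apply: eq_bigr => i _.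
  by rewrite -sumrB; apply: eq_bigr => j _; rewrite -scalerBl.
apply: eq_bigr => i _; apply: eq_bigr => j _.
by rewrite kronecker_ext2_wedge !aE.
Qed.

Lemma kronecker2_linearl (z : homology2 G) : linear (fun x => @kronecker2 G x z).
Proof.
move=> t x y; have [{}x ->] := quotmod_surj x.
have [{}y ->] := quotmod_surj y; have [{}z ->] := quotmod_surj z.
rewrite -!/(quotmod_pi _ _) -linearP !kronecker2E !fglift_sum scaler_sumr.
rewrite -big_split; apply: eq_bigr => g _.
rewrite /= !fctE scalerDr; congr (_ + _).
by rewrite !scalerA mulrC.
Qed.

Definition wedge_chain : {freeg (G * G) / rat} -> ext2 (homology1 G) :=
  fglift (fun p => wedge (group_class p.1) (group_class p.2)).
HB.instance Definition _ := GRing.Linear.on wedge_chain.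

(** The image of [wedge_chain] in the free Lie algebra. It is defined on all chains, so that it can
    be evaluated on lifts of cycles that are not cycles themselves. *)
Definition lie_chain : {freeg (G * G) / rat} -> free_lie (homology1 G) :=
  fglift (fun p => lie (free_lie_gen (group_class p.1))
                       (free_lie_gen (group_class p.2))).
HB.instance Definition _ := GRing.Linear.on lie_chain.

Lemma lie_chainU g h : lie_chain << (g, h) >> =
  lie (free_lie_gen (group_class g)) (free_lie_gen (group_class h)).
Proof. exact: fgliftU. Qed.

Lemma kronecker_wedge_chain (a b : kermod (@cobar1 G)) z :
  kronecker_ext2 (wedge (quotmod_pi _ a) (quotmod_pi _ b)) (wedge_chain z)
  = fglift (cup_cochain (val a) (val b)) z
    - fglift (cup_cochain (val b) (val a)) z.
Proof.
move: z; apply: freeg_ext => [t x y|t x y|[g h]].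
- by rewrite linearP kronecker_ext2_linearr.
- by rewrite !(linearP (fglift _)) scalerBr opprD addrACA.
rewrite /wedge_chain !fgliftU /= kronecker_ext2_wedge !kronecker1_class /cup_cochain /=.
by congr (_ - _); apply: mulrC.
Qed.

(* The coboundary of the pointwise product of a and b is minus the symmetrized
   cup product. *)
Lemma cup_cochain_anticomm (a b : kermod (@cobar1 G)) z : bar2 z = 0 ->
  fglift (cup_cochain (val b) (val a)) z
  = - fglift (cup_cochain (val a) (val b)) z.
Proof.
move=> z0; pose c g : rat^o := (val a g : rat) * val b g.
suff cE y : fglift (cobar1 c) y = - (fglift (cup_cochain (val b) (val a)) y
    + fglift (cup_cochain (val a) (val b)) y).
  by apply/eqP; rewrite -addr_eq0 -oppr_eq0 -cE fglift_cobar1 z0 linear0.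
move: y; apply: freeg_ext => [t x y|t x y|[g h]].
- exact: linearP.
- by rewrite !(linearP (fglift _)) addrACA -scalerDr opprD scalerN.
rewrite !fgliftU /cup_cochain /cobar1 /c /= !cocycle1M.
have E (x y x' y' : rat) :
  x' * y' - (x + x') * (y + y') + x * y = - (y * x' + x * y') by ring.
exact: E.
Qed.

(** On a cycle the cup products in the two orders have opposite values, so [wedge_chain] pairs to
    twice the cup product. Nondegeneracy identifies half of it with the element chosen by [xget]. *)
Lemma cup_dualE : finitely_generated G -> forall k : kermod (@bar2 G),
  cup_dual (quotmod_pi _ k) = (2%:R : rat)^-1 *: wedge_chain (val k).
Proof.
move=> fgG k; have k0 : bar2 (val k) = 0 by apply/eqP; case: k.
have kE x : kronecker_ext2 x ((2%:R : rat)^-1 *: wedge_chain (val k))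
    = kronecker2 (cup_map x) (quotmod_pi _ k).
  move: x; apply: ext2_ext => [||a b].
  - exact: kronecker_ext2_linearl.
  - by move=> t x y; rewrite cup_map_linear kronecker2_linearl.
  have [{}a ->] := cohomology1_surj a; have [{}b ->] := cohomology1_surj b.
  rewrite cup_map_wedge cupE kronecker2E.
  rewrite -[LHS]/(linear_pack (kronecker_ext2_linearr _) _) linearZ /=.
  rewrite kronecker_wedge_chain (cup_cochain_anticomm a b k0) opprK.
  exact: rat_half.
apply: xget_unique => // w wE; apply: kronecker_ext2_nondegenerate => // x.
by rewrite wE kE.
Qed.

Lemma ext2_free_lie_linear (V : lmodType rat) : linear (@ext2_free_lie rat V).
Proof.
apply: ext2_lift_linear => [w a u v|w a u v|w]; last exact: liexx.
  by rewrite linearP lie_linearl.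
by rewrite linearP lie_linearr.
Qed.

Lemma ext2_free_lie_chain z : ext2_free_lie (wedge_chain z) = lie_chain z.
Proof.
move: z; apply: freeg_ext => [a x y|a x y|[g h]].
- by rewrite linearP ext2_free_lie_linear.
- exact: linearP.
- by rewrite lie_chainU /wedge_chain fgliftU ext2_free_lie_wedge.
Qed.

(** The factor 1/2 is absorbed by rescaling the cycle. *)
Lemma holonomy_relationsE : finitely_generated G -> forall x,
  holonomy_relations x <-> exists2 z, bar2 z = 0 & x = lie_chain z.
Proof.
move=> fgG x; split=> [[y _ <-]|[z z0 ->]].
  have [k ->] := quotmod_surj y.
  exists ((2%:R : rat)^-1 *: val k).
    by rewrite linearZ /=; case: k => k /= /eqP ->; rewrite scaler0.
  rewrite -/(quotmod_pi _ _) cup_dualE //.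
  by rewrite -ext2_free_lie_chain linearZ.
have kP : in_ker (@bar2 G) (2%:R *: z) by apply/eqP; rewrite linearZ /= z0 scaler0.
exists (quotmod_pi _ (Kermod kP)) => //.
by rewrite cup_dualE // linearZ /= scalerA mulVf // scale1r ext2_free_lie_chain.
Qed.

End CupDual.

(** The preimage of an ideal under a Lie morphism is an ideal. *)
Lemma ideal_gen_map (K : comNzRingType) (L M : gradedLieType K) (S : set L)
    (J : lie_ideal M) (f : {linear L -> M}) :
  {morph f : x y / lie x y >-> lie x y} ->
  (forall x, S x -> J (f x)) -> forall x, ideal_gen S x -> J (f x).
Proof.
move=> flie SJ x Sx; pose T : set L := [set x | J (f x)].
have T0 : T 0 by rewrite /T /= linear0; apply: submodule0.
have TP a u v : T u -> T v -> T (a *: u + v).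
  by move=> Tu Tv; rewrite /T /= linearP; apply: submoduleP.
have Tlie u v : Submodule T0 TP v -> Submodule T0 TP (lie u v).
  by move=> Tv; rewrite /= /T /= flie; apply: lie_idealP.
exact: (Sx (LieIdeal Tlie)).
Qed.

Definition holonomy_ideal (G : groupType) : graded_ideal (free_lie (homology1 G)) :=
  graded_ideal_gen (@holonomy_relations_homog G).

(** * Cycles of quotient groups *)

Section NullChains.
Variable G : groupType.

(* Boundaries which can be removed without changing the holonomy relation that a
   chain represents. *)
Definition null_boundary : set {freeg G / rat} :=
  [set b | exists2 u, bar2 u = b & lie_chain u = 0].

Fact null_boundary0 : null_boundary 0.
Proof. by exists 0; rewrite linear0. Qed.

Fact null_boundaryP a u v :
  null_boundary u -> null_boundary v -> null_boundary (a *: u + v).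
Proof.
move=> [x <- x0] [y <- y0]; exists (a *: x + y); rewrite linearP //.
by rewrite /= x0 y0 scaler0 addr0.
Qed.

Definition null_boundaries : submodule {freeg G / rat} :=
  Submodule null_boundary0 null_boundaryP.

Lemma null_boundary_bar2 g h :
  group_class h = 0 -> null_boundaries (bar2 << (g, h) >>).
Proof.
by move=> h0; exists << (g, h) >> => //; rewrite lie_chainU h0 linear0 lie0r.
Qed.

(** Modulo null boundaries, [g] maps additively to its chain as long as the right factor has class
    zero. Here the entries of the commutators lie in term [i.+1], so their classes vanish and the
    commutators die. *)
Lemma null_boundary_derived i n :
  derived_set (G := G) i.+2 n -> null_boundaries << n >>.
Proof.
pose tau (g : G) := quotmod_pi null_boundaries << g >>.
have tauM x y : group_class y = 0 -> tau (x * y)%g = tau x + tau y.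
  move=> y0; apply/esym/eqP; rewrite -subr_eq0 /tau -linearD -linearB.
  apply/eqP/quotmod_pi_eq0; rewrite [<< x >> + _]addrC addrAC -bar2U.
  exact: null_boundary_bar2.
have cls1 : group_class (1 : G)%g = 0 by exact: additive1 (@group_classM G).
have clsV (x : G) : group_class x^-1%g = - group_class x.
  exact: additiveV (@group_classM G) x.
have tau1 : tau 1%g = 0.
  by apply: (addrI (tau 1%g)); rewrite -tauM // mulg1 addr0.
have tauV x : group_class x = 0 -> tau x^-1%g = - tau x.
  by move=> x0; apply/eqP; rewrite -addr_eq0 -tauM // mulVg tau1.
(* The vanishing of the class is carried along because additivity of [tau] depends on it. *)
pose T : set G := [set x | group_class x = 0 /\ tau x = 0].
have T1 : T 1%g by [].
have TM x y : T x -> T y -> T (x * y)%g.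
  by move=> [x0 tx] [y0 ty]; rewrite /T /= group_classM tauM // x0 y0 tx ty !addr0.
have TV x : T x -> T x^-1%g.
  by move=> [x0 tx]; rewrite /T /= clsV tauV // x0 tx !oppr0.
move=> Dn; suff : T n by case=> _ /quotmod_pi_eq0.
apply: (Dn (Subgroup T1 TM TV)) => _ [x [y [Dx Dy ->]]].
have x0 : group_class x = 0 by exact: additive_derived (@group_classM G) _ _ Dx.
have y0 : group_class y = 0 by exact: additive_derived (@group_classM G) _ _ Dy.
have xV0 : group_class x^-1%g = 0 by rewrite clsV x0 oppr0.
have yV0 : group_class y^-1%g = 0 by rewrite clsV y0 oppr0.
rewrite /= /T /= commgEl /conjg !tauM ?group_classM ?x0 ?y0 ?xV0 ?yV0 ?addr0 //.
by split=> //; rewrite !tauV // addrA -opprD addNr.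
Qed.

End NullChains.

(** * Comparison of a group with its quotient by a subgroup that vanishes in H_1 *)

Section Quotient.
Variables (G : groupType) (N : normal_subgroup G).
Hypothesis fgG : finitely_generated G.
Hypothesis N0 : forall n, N n -> group_class n = 0.

Local Notation Q := (quotgroup N).
Local Notation qpi := (@quotgroup_pi G N).

Lemma finitely_generated_quotgroup : finitely_generated Q.
Proof.
have [s sG] := fgG; exists (map qpi s) => x; have [{}x ->] := quotgroup_surj x.
set H := subgroup_gen _.
have H1 : H (qpi 1%g) by apply: (subgroup1 H).
have HM y z : H (qpi y) -> H (qpi z) -> H (qpi (y * z)%g).
  by rewrite quotgroup_piM; apply: (subgroupM (s := H)).
have HV y : H (qpi y) -> H (qpi y^-1%g).
  by rewrite -quotgroup_invE; apply: (subgroupV (s := H)).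
apply: (sG x (@Subgroup _ [set y | H (qpi y)] H1 HM HV)) => y ys.
by apply: sub_subgroup_gen; apply/mapP; exists y.
Qed.

Lemma group_class_repr g : group_class (repr (qpi g)) = group_class g.
Proof.
rewrite -[repr _](mulVKg g) group_classM (N0 (quotgroup_repr N g)).
exact: addr0.
Qed.

Fact to_quot_morph :
  {morph (fun g => group_class (qpi g)) : g h / (g * h)%g >-> g + h}.
Proof. by move=> g h; rewrite quotgroup_piM group_classM. Qed.

(** The section [repr] need not be multiplicative, but the class of a representative depends only on
    the coset. *)
Fact from_quot_morph :
  {morph (fun q : Q => group_class (repr q)) : p q / (p * q)%g >-> p + q}.
Proof.
move=> p q; have [g ->] := quotgroup_surj p; have [h ->] := quotgroup_surj q.
by rewrite -quotgroup_piM !group_class_repr group_classM.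
Qed.

Definition to_quot := linear_pack (homology1_lift_linear to_quot_morph).
Definition from_quot := linear_pack (homology1_lift_linear from_quot_morph).

Lemma to_quot_class g : to_quot (group_class g) = group_class (qpi g).
Proof. exact: homology1_lift_class to_quot_morph g. Qed.

Lemma from_quot_class q : from_quot (group_class q) = group_class (repr q).
Proof. exact: homology1_lift_class from_quot_morph q. Qed.

Lemma to_quotK : cancel to_quot from_quot.
Proof.
apply: homology1_ext => [a x y|//|g]; first by rewrite !linearP.
by rewrite to_quot_class from_quot_class group_class_repr.
Qed.

Lemma from_quotK : cancel from_quot to_quot.
Proof.
apply: homology1_ext => [a x y|//|q]; first by rewrite !linearP.
by rewrite from_quot_class to_quot_class /quotgroup_pi reprK.
Qed.

Definition push1 : {freeg G / rat} -> {freeg Q / rat} :=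
  fglift (fun g => << qpi g >>).
Definition push2 : {freeg (G * G) / rat} -> {freeg (Q * Q) / rat} :=
  fglift (fun p => << (qpi p.1, qpi p.2) >>).
(** The lifts along [repr] need not commute with [bar2]; [null_boundary_section] controls the
    defect. *)
Definition section1 : {freeg Q / rat} -> {freeg G / rat} :=
  fglift (fun q : Q => << (repr q : G) >>).
Definition section2 : {freeg (Q * Q) / rat} -> {freeg (G * G) / rat} :=
  fglift (fun p : Q * Q => << (repr p.1 : G, repr p.2 : G) >>).

HB.instance Definition _ := GRing.Linear.on push1.
HB.instance Definition _ := GRing.Linear.on push2.
HB.instance Definition _ := GRing.Linear.on section1.
HB.instance Definition _ := GRing.Linear.on section2.

Lemma push1U g : push1 << g >> = << qpi g >>. Proof. exact: fgliftU. Qed.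
Lemma push2U g h : push2 << (g, h) >> = << (qpi g, qpi h) >>.
Proof. exact: fgliftU. Qed.
Lemma section1U q : section1 << q >> = << repr q >>. Proof. exact: fgliftU. Qed.
Lemma section2U p q : section2 << (p, q) >> = << (repr p, repr q) >>.
Proof. exact: fgliftU. Qed.

Lemma bar2_push z : bar2 (push2 z) = push1 (bar2 z).
Proof.
move: z; apply: freeg_ext => [a x y|a x y|[g h]]; try by rewrite !linearP.
by rewrite push2U !bar2U linearD linearB /= !push1U quotgroup_piM.
Qed.

Lemma section2K : cancel section2 push2.
Proof.
apply: freeg_ext => [a x y|//|[p q]]; first by rewrite !linearP.
by rewrite section2U push2U /quotgroup_pi !reprK.
Qed.

Lemma to_quot_lie_chain z :
  free_lie_map to_quot (lie_chain z) = lie_chain (push2 z).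
Proof.
move: z; apply: freeg_ext => [a x y|a x y|[g h]]; try by rewrite !linearP.
by rewrite push2U !lie_chainU free_lie_map_lie !free_lie_map_gen !to_quot_class.
Qed.

Lemma from_quot_lie_chain z :
  free_lie_map from_quot (lie_chain z) = lie_chain (section2 z).
Proof.
move: z; apply: freeg_ext => [a x y|a x y|[g h]]; try by rewrite !linearP.
by rewrite section2U !lie_chainU free_lie_map_lie !free_lie_map_gen !from_quot_class.
Qed.

Lemma to_quot_ideal x :
  holonomy_ideal G x -> holonomy_ideal Q (free_lie_map to_quot x).
Proof.
apply: ideal_gen_map => [|{}x /(holonomy_relationsE fgG)[z z0 ->]].
  exact: free_lie_map_lie.
apply: sub_ideal_gen; apply/(holonomy_relationsE finitely_generated_quotgroup).
by exists (push2 z); rewrite ?to_quot_lie_chain // bar2_push z0 linear0.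
Qed.

Lemma from_quot_surj y : exists x, y = free_lie_map from_quot x.
Proof. by exists (free_lie_map to_quot y); rewrite free_lie_mapK //; apply: to_quotK. Qed.

Lemma null_boundary_section b : (forall n, N n -> null_boundaries G << n >>) ->
  null_boundaries G (b - section1 (push1 b)).
Proof.
move=> Nnull; pose T : set {freeg G / rat} :=
  [set b | null_boundaries G (b - section1 (push1 b))].
have T0 : T 0 by rewrite /T /= !linear0 addr0; apply: null_boundary0.
have TP a u v : T u -> T v -> T (a *: u + v).
  move=> Tu Tv; rewrite /T /= (linearP push1) (linearP section1).
  by rewrite opprD addrACA -scalerBr; apply: null_boundaryP.
apply: (@freeg_ind _ _ (Submodule T0 TP)) => g.
rewrite /= /T /= push1U section1U; have Ng := quotgroup_repr N g.
(* The representative of the coset of [g] is [g * n] with [n] in [N]. *)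
rewrite -[repr _](mulVKg g); set n := (_ * repr _)%g in Ng *.
have -> : << g >> - << (g * n)%g >> = bar2 << (g, n) >> - << n >>.
  by rewrite bar2U [RHS]addrC -[in RHS]addrA addKr addrC.
apply: (submoduleB (W := null_boundaries G)); last exact: Nnull.
exact/null_boundary_bar2/N0.
Qed.

(** The map induced by [from_quot], followed by the projection, is onto; its kernel is the holonomy
    ideal of the quotient because relations correspond in both directions. *)
Lemma holonomy_quotgroup : (forall n, N n -> null_boundaries G << n >>) ->
  graded_lie_isomorphic (holonomy Q) (holonomy G).
Proof.
move=> Nnull; pose F := free_lie_map from_quot.
apply: (@first_isomorphism _ _ _ (holonomy_ideal Q)
  (lie_quot_pi (holonomy_ideal G) \o F)) => [x y|n x|y|x].
- by rewrite /= free_lie_map_lie lie_quot_pi_lie.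
- by rewrite /= free_lie_map_homog lie_quot_pi_homog.
- have [x ->] := lie_quot_pi_surj y; have [z ->] := from_quot_surj x.
  by exists z.
split=> [/lie_quot_pi_eq0/to_quot_ideal|Ix].
  by rewrite (free_lie_mapK from_quotK).
apply/lie_quot_pi_eq0; move: x Ix.
apply: ideal_gen_map => [|x /(holonomy_relationsE finitely_generated_quotgroup)].
  exact: free_lie_map_lie.
move=> [z z0 ->]; rewrite from_quot_lie_chain; apply: sub_ideal_gen.
(* The boundary of the lift pushes forward to [bar2 z], which is zero, so this boundary is itself
   null. Subtracting [u] turns the lift into a cycle with the same [lie_chain]. *)
have := null_boundary_section (bar2 (section2 z)) Nnull.
rewrite -bar2_push section2K z0 linear0 subr0 => -[u uz u0].
apply/(holonomy_relationsE fgG); exists (section2 z - u).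
  by rewrite linearB /= uz subrr.
by rewrite linearB /= u0 subr0.
Qed.

Lemma holonomy_abelian_quotgroup : (forall p q : Q, (p * q = q * p)%g) ->
  graded_lie_isomorphic (holonomy Q) (lie_quot (derived_ideal (holonomy G))).
Proof.
move=> Qcomm; pose F := free_lie_map from_quot.
have Ibr x y : holonomy_ideal Q (lie x y).
  apply: ideal_contains_brackets => {x y} v w.
  have [{}v ->] := chain_class_surj v; have [{}w ->] := chain_class_surj w.
  rewrite !chain_classE !fglift_sum !linear_sum /=.
  apply: (submodule_sum (W := holonomy_ideal Q)) => q _; rewrite lie_suml.
  apply: (submodule_sum (W := holonomy_ideal Q)) => p _; rewrite !linearZ /= lieZl.
  do 2!apply: (submoduleZ (W := holonomy_ideal Q)).
  apply: sub_ideal_gen; apply/(holonomy_relationsE finitely_generated_quotgroup).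
  (* A cycle by commutativity; antisymmetry of the bracket doubles its value, hence the factor
     1/2. *)
  exists ((2%:R : rat)^-1 *: (<< (p, q) >> - << (q, p) >>)).
    rewrite linearZ linearB /= !bar2U [(q * p)%g]Qcomm.
    by rewrite [X in _ - X]addrC addrA addrAC subrr scaler0.
  rewrite linearZ linearB /= !lie_chainU.
  by rewrite [X in _ - X]lieC opprK rat_half.
apply: (@first_isomorphism _ _ _ (holonomy_ideal Q)
  (lie_quot_pi (derived_ideal (holonomy G)) \o
    (lie_quot_pi (holonomy_ideal G) \o F))) => [x y|n x|y|x].
- by rewrite /= free_lie_map_lie !lie_quot_pi_lie.
- by rewrite /= free_lie_map_homog !lie_quot_pi_homog.
- have [{}y ->] := lie_quot_pi_surj y; have [x ->] := lie_quot_pi_surj y.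
  by have [z ->] := from_quot_surj x; exists z.
split=> [/lie_quot_pi_eq0 Dx|Ix].
  (* Classes with a lift that [to_quot] sends into the holonomy ideal of [Q]. They include all
     brackets by [Ibr], hence the whole derived ideal; two lifts of a class differ by an element of
     the holonomy ideal of [G], so the lift [F x] has this property too. *)
  pose T : set (holonomy G) := [set y | exists2 t,
    y = lie_quot_pi (holonomy_ideal G) t &
    holonomy_ideal Q (free_lie_map to_quot t)].
  have T0 : T 0 by exists 0; rewrite !linear0 //; apply: submodule0.
  have TP a u v : T u -> T v -> T (a *: u + v).
    move=> [t -> tI] [s -> sI]; exists (a *: t + s); rewrite linearP //.
    exact: submoduleP.
  have [|t /eqP xt tI] := Dx (Submodule T0 TP).
    move=> _ [u [v ->]]; have [{}u ->] := lie_quot_pi_surj u.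
    have [{}v ->] := lie_quot_pi_surj v.
    exists (lie u v); first by rewrite lie_quot_pi_lie.
    by rewrite free_lie_map_lie; apply: Ibr.
  move: xt; rewrite -subr_eq0 -(linearB (lie_quot_pi (holonomy_ideal G))).
  move=> /eqP/lie_quot_pi_eq0/to_quot_ideal.
  rewrite linearB /= (free_lie_mapK from_quotK) => xI.
  rewrite -[x](subrK (free_lie_map to_quot t)).
  exact: (submoduleD (W := holonomy_ideal Q)).
(* Conversely, every holonomy relation is a combination of brackets. *)
apply/lie_quot_pi_eq0; move: x Ix; apply: ideal_gen_map => [x y|x].
  by rewrite /= free_lie_map_lie lie_quot_pi_lie.
move=> /(holonomy_relationsE finitely_generated_quotgroup)[z _ ->].
rewrite /= from_quot_lie_chain /lie_chain fglift_sum linear_sum.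
apply: (submodule_sum (W := derived_ideal (holonomy G))) => p _; rewrite linearZ.
apply: (submoduleZ (W := derived_ideal (holonomy G))).
rewrite /= lie_quot_pi_lie; apply: sub_span.
by exists (lie_quot_pi (holonomy_ideal G) (free_lie_gen (group_class p.1))),
  (lie_quot_pi (holonomy_ideal G) (free_lie_gen (group_class p.2))).
Qed.

End Quotient.

Theorem proposition6p3 (G : groupType) (fgG : finitely_generated G) :
  graded_lie_isomorphic
    (holonomy (quotgroup (derived_series G 1)))
    (lie_quot (derived_ideal (holonomy G)))
  /\
  (forall i : nat, (2 <= i)%N ->
    graded_lie_isomorphic
      (holonomy (quotgroup (derived_series G i)))
      (holonomy G)).
Proof.
have D0 i n : derived_series G i.+1 n -> group_class n = 0.
  exact: additive_derived (@group_classM G) _ _.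
split=> [|[|[|i]] // _].
  apply: holonomy_abelian_quotgroup => //; first exact: D0.
  move=> p q; have [x ->] := quotgroup_surj p; have [y ->] := quotgroup_surj q.
  rewrite -!quotgroup_piM; apply/quotgroup_piP/sub_subgroup_gen.
  (* The inverse of [x * y] times [y * x] is the commutator of [y] and [x], in this order. *)
  exists y, x; split=> //.
  by rewrite commgEl /conjg invgM !mulgA.
apply: holonomy_quotgroup => //; first exact: D0.
by move=> n; apply: null_boundary_derived.
Qed.
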